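(* Consider the algorithm $\Gamma$ described below, run on input $(\sigma,w,\delta,\gamma)$. Then: (a) $r(n+1)\ge \mathrm{dmin}(\sigma,w)$ always; (b) $\Pr[r(n+1)>(1+\delta)\mathrm{dmin}(\sigma,w)]\le\gamma/2$; (c) the probability that $|R|$ ever exceeds $\frac{2e^2}{\delta}\ln(2\rho)\ln(4n^3/\gamma)$ is at most $\gamma/2$, where $\rho=\sum_{i=1}^n w(i)$.
   Context: Let $P$ be a set with partial order $\triangleleft$. The input is $\delta\in(0,1]$, $\gamma>0$, and a weighted $P$-sequence: elements $\sigma(1),\ldots,\sigma(n)\in P$ with nonnegative integer weights $w(1),\ldots,w(n)$. For $J\subseteq[n]$, $w(J)=\sum_{j\in J}w(j)$. A $\sigma$-path is a sequence of indices $\pi_1<\cdots<\pi_k$ in $[n]$ with $\sigma(\pi_1)\triangleleft\cdots\triangleleft\sigma(\pi_k)$; its defect is $w([n]\setminus\pi)$, and $\mathrm{dmin}(\sigma,w)$ is the minimum defect over all $\sigma$-paths. Extend the sequence by an element $\sigma(n+1)$ greater than all elements of $P$ with $w(n+1)=0$, and by an index $0$ with $\sigma(0)$ below all elements. Write $i\to t$ for $i<t$ and $\sigma(i)\triangleleft\sigma(t)$ (so $0\to t$ and $i\to n+1$ for all relevant $i,t$). Define $q(i,t)=\min\{1,\frac{1+\delta}{\delta}\ln(4t^3/\gamma)\frac{w(i)}{W(t)-W(i-1)}\}$, $p(i,i)=1$ and $p(i,t)=q(i,t)/q(i,t-1)$ for $t>i$, where $W(t)=w(1)+\cdots+w(t)$.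 Algorithm $\Gamma$: initialize $R=\{0\}$, $r(0)=0$, $W(0)=0$. For each $t=1,\ldots,n+1$ in order: (1) set $W(t)=W(t-1)+w(t)$; (2) set $r(t)=\min\{r(i)+W(t-1)-W(i): i\in R,\ i\to t\}$; (3) insert $t$ into $R$, then discard each $i\in R$, $i\ge 1$, independently with probability $1-p(i,t)$ (index $0$ is never discarded). The output is $r(n+1)$.
   Formalization: Discarding with probability 1−p(i,t) is read with p(i,t) truncated to [0,1], since p(i,t) can exceed 1 (e.g. when w(t)=0); 0/0 in q and p, arising for weight-0 indices, is read as 0; part (c) assumes ρ>0, since ln(2ρ) is undefined at ρ=0. *)

(* Defs.v *)
From HB Require Import structures.
From mathcomp Require Import all_boot all_order all_algebra.
From mathcomp Require Import reals sequences exp.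

Set Implicit Arguments.
Unset Strict Implicit.
Unset Printing Implicit Defensive.

Import Order.TTheory GRing.Theory Num.Theory.
Local Open Scope ring_scope.

(* The input positions 1, ..., n are the ordinals j : 'I_n, with j standing   *)
(* for position j.+1.  The positions 0, 1, ..., n.+1 handled by the algorithm *)
(* are natural numbers, or elements of 'I_n.+2 when a finite type is needed.  *)

Section Paths.

Variables (P : Type) (prec : rel P) (n : nat) (sigma : 'I_n -> P).
Variable w : 'I_n -> nat.

(* A path is given by the set of its indices; since enum lists the elements   *)
(* of S in increasing order, enum S is the sequence pi_1 < ... < pi_k.        *)
Definition sigma_path (S : {set 'I_n}) : bool :=
  sorted (fun i j => prec (sigma i) (sigma j)) (enum S).

Definition defect (S : {set 'I_n}) : nat := (\sum_(j in ~: S) w j)%N.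

(* The default value is the defect of the empty path, so this is the minimum. *)
Definition dmin : nat :=
  \big[minn/defect set0]_(S : {set 'I_n} | sigma_path S) defect S.

Definition total_weight : nat := (\sum_(j < n) w j)%N.

End Paths.

Section Algorithm.

Variables (R : realType) (P : Type) (prec : rel P) (n : nat).
Variables (sigma : 'I_n -> P) (w : 'I_n -> nat) (delta gamma : R).

(* None for the two added positions 0 and n.+1. *)
Definition input_pos (t : nat) : option 'I_n :=
  if t is t'.+1 then insub t' else None.

Definition wt (t : nat) : nat := if input_pos t is Some j then w j else 0%N.

(* W(t) = w(1) + ... + w(t) *)
Definition W (t : nat) : nat := (\sum_(1 <= j < t.+1) wt j)%N.

(* For i < t <= n.+1, a missing input position means i = 0 or t = n.+1, where *)
(* the relation holds because sigma(0) is below and sigma(n+1) above all.     *)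
Definition arrow (i t : nat) : bool :=
  (i < t)%N &&
  match input_pos i, input_pos t with
  | Some a, Some b => prec (sigma a) (sigma b)
  | _, _ => true
  end.

(* As 0 / 0 = 0, one has q i t = 0 whenever w(i) = 0. *)
Definition q (i t : nat) : R :=
  Num.min 1 ((1 + delta) / delta * ln (4 * t%:R ^+ 3 / gamma)
             * ((wt i)%:R / ((W t)%:R - (W i.-1)%:R))).

Definition p (i t : nat) : R := if i == t then 1 else q i t / q i t.-1.

(* The ratio p i t may leave [0, 1]: it exceeds 1 when the logarithm grows    *)
(* faster than the weight (in particular when w(t) = 0 and q i t.-1 < 1), and *)
(* ln is nonpositive for large gamma.  Discarding with probability 1 - p i t  *)
(* then means never (p i t >= 1) or surely (p i t <= 0) discarding.           *)
Definition keep_prob (i t : nat) : R := Num.max 0 (Num.min 1 (p i t)).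

(* One coin per pair (i, t), true meaning that i is kept at step t.  The      *)
(* coins with i = 0, or with i not in the memory at step t, are ignored.      *)
Definition coins := {ffun 'I_n.+2 * 'I_n.+2 -> bool}.

Definition coins_prob (omega : coins) : R :=
  \prod_(c : 'I_n.+2 * 'I_n.+2)
    (if omega c then keep_prob c.1 c.2 else 1 - keep_prob c.1 c.2).

Definition Pr (A : pred coins) : R := \sum_(omega | A omega) coins_prob omega.

Record state := State { memory : {set 'I_n.+2}; dist : 'I_n.+2 -> nat }.

Definition init_state : state := State [set ord0] (fun=> 0%N).

Definition candidate (s : state) (t i : 'I_n.+2) : nat :=
  (dist s i + (W t.-1 - W i))%N.

(* Index 0 is always in the memory and precedes t, so its candidate value is  *)
(* a harmless default for the minimum.                                        *)
Definition new_dist (s : state) (t : 'I_n.+2) : nat :=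
  \big[minn/candidate s t ord0]_(i in memory s | arrow i t) candidate s t i.

Definition inserted (s : state) (t : 'I_n.+2) : {set 'I_n.+2} :=
  t |: memory s.

Definition step (omega : coins) (s : state) (t : 'I_n.+2) : state :=
  State [set i in inserted s t | (i == ord0) || omega (i, t)]
        (fun i => if i == t then new_dist s t else dist s i).

Fixpoint run (omega : coins) (t : nat) : state :=
  if t is t'.+1 then step omega (run omega t') (inord t) else init_state.

Definition output (omega : coins) : nat := dist (run omega n.+1) ord_max.

(* The size of the memory exceeds B at some moment: at the end of one of the  *)
(* steps 0, ..., n.+1, or between the insertion and the discarding phases of  *)
(* one of the steps 1, ..., n.+1.                                             *)
Definition memory_exceeds (B : R) (omega : coins) : bool :=
  [exists t : 'I_n.+2, B < #|memory (run omega t)|%:R] ||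
  [exists t : 'I_n.+2, (0 < t)%N && (B < #|inserted (run omega t.-1) t|%:R)].

Definition memory_bound : R :=
  2 * expR 1 ^+ 2 / delta * ln (2 * (total_weight w)%:R)
  * ln (4 * n%:R ^+ 3 / gamma).

End Algorithm.

(* Main.v *)
Require Import Defs.
From mathcomp Require Import all_boot all_order all_algebra.
From mathcomp Require Import ring lra zify.
From mathcomp Require Import reals normedtype derive sequences exp.

Import Order.TTheory GRing.Theory Num.Theory.
Import numFieldNormedType.Exports.
Local Open Scope ring_scope.

Set Implicit Arguments.
Unset Strict Implicit.
Unset Printing Implicit Defensive.

(* Let C be the indices of positive weight of an optimal path, and let B be the
   remaining indices.  Call an interval good if its C-weight exceeds delta times
   its B-weight.  If at every time t each good interval ]m, t] still contains an
   index of C in the memory, then following from t the last remembered index of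
   C never costs more than 1 + delta times the B-weight passed over, hence the
   output is at most (1 + delta) w(B).

   Clipping p(i, t) to [0, 1] makes the survival probability of i possibly
   smaller than q(i, t), and the union bound over t alone is then too weak.
   With L_j = ln (4 (j+1)^3 / gamma) and kappa = (1 + delta) / delta, the
   survival probability of j at time t is still at least
   min (1, kappa L_j w(j) / w[a, t]) for every a <= j.  For a fixed left end a,
   the probability that the path indices of [a, t] are all lost at some t
   depends monotonically on the survival functions, so that these lower bounds
   may be taken for the exact survival probabilities.  The loss probabilities at
   the times t are then products whose increments, by the convexity of
   x exp (- x) for x >= 2 and by goodness, are at most
   e sum_j exp (- L_j) (z_j(t-1) - z_j(t)), with z_j(t) that lower bound.
   Summed over t this telescopes to e sum_(j >= a) exp (- L_j), and summing over
   a gives e (gamma / 4) sum_j j / (j+1)^3 <= e gamma / 8 <= gamma / 2.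

   The size of the memory is a sum of independent indicators of mean at most
   (2 / delta) ln (4 n^3 / gamma) (1 + ln rho), up to at most three indices, and
   is bounded by a Chernoff bound. *)

(** * Bounds on the exponential *)

Section ExpBounds.
Variable R : realType.
Implicit Types x m : R.

(** This is the monotonicity of the derivative [(1 - x) * expR (- x)], that is, convexity beyond 2.
    Bounding [expR (x - m)] below by [1 + (x - m)] leaves [(m - 2) * (x - m) >= 0]. *)
Lemma expRN_antitone_slope x m : 2 <= m -> m <= x ->
  (x - 1) * expR (- x) <= (m - 1) * expR (- m).
Proof.
move=> m2 mx; have -> : - m = - x + (x - m) by ring.
rewrite expRD mulrCA mulrC ler_pM2l ?expR_gt0//.
have := expR_ge1Dx (x - m); nra.
Qed.

Lemma mulr_expRN_tangent x m : 2 <= m -> 2 <= x ->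
  m * expR (- m) + (1 - m) * expR (- m) * (x - m) <= x * expR (- x).
Proof.
move=> m2 x2.
pose g (y : R) := y * expR (- y); pose g' (y : R) := (1 - y) * expR (- y).
have dg y : is_derive y (1 : R) g (g' y).
  rewrite /g /g'; apply: is_derive_eq.
  by rewrite /GRing.scale/=; ring.
have dvg (y : R) : derivable g y 1 by have /@ex_derive := dg y.
have main : exists2 c, (1 - m) * expR (- m) * (x - m) <= g' c * (x - m) &
     g x - g m = g' c * (x - m).
  have cg (a b : R) := @derivable_within_continuous R _ g `[a, b] (fun y _ => dvg y).
  have [mx|/ltW xm] := leP m x.
    have [c] := MVT_segment mx (fun y _ => dg y) (cg m x).
    rewrite in_itv/= => /andP[mc cx] E; exists c => //.
    apply: ler_wpM2r; first by rewrite subr_ge0.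
    have := expRN_antitone_slope m2 mc; rewrite /g'; lra.
  have [c] := MVT_segment xm (fun y _ => dg y) (cg x m).
  rewrite in_itv/= => /andP[xc cm] E; exists c; last by lra.
  have := expRN_antitone_slope (le_trans x2 xc) cm; rewrite /g'; nra.
case: main => c le1; rewrite /g => E; lra.
Qed.

Lemma expR1_le4 : expR 1 <= 4 :> R.
Proof.
have b1 := @expR_ge1Dx R (- (2^-1)).
have ab := expRxMexpNx_1 (2^-1 : R).
have a0 := expR_gt0 (2^-1 : R).
have -> : 1 = 2^-1 + 2^-1 :> R by lra.
rewrite expRD; set a := expR 2^-1 in ab a0 *; set b := expR _ in ab b1.
have a2 : a <= 2 by nra.
nra.
Qed.

(** The constant 6 makes the memory bound at least 3 when its logarithmic factors are only known to
    be at least 1/2. *)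
Lemma expR1_sqr_ge6 : 6 <= expR 1 ^+ 2 :> R.
Proof.
have y1 := @expR_ge1Dx R (6^-1).
(* Six factors suffice: [(7 / 6) ^+ 6] is just above 5/2. *)
have E : expR 1 = expR (6^-1 : R) ^+ 6 by rewrite -expRM_natl mulfV ?pnatr_eq0.
have : 5 / 2 <= expR 1 :> R.
  rewrite E; apply: (@le_trans _ _ ((7 / 6) ^+ 6)); first by lra.
  by rewrite lerXn2r ?nnegrE; lra.
nra.
Qed.

Lemma ln2_ge_half : 1 / 2 <= ln 2 :> R.
Proof.
rewrite -ler_expR lnK ?posrE//; have := expR1_le4.
have -> : (1 : R) = 1 / 2 + 1 / 2 by lra.
rewrite expRD -(_ : 1 = 1 / 2 + 1 / 2 :> R); last by lra.
have := expR_gt0 (1 / 2 : R); nra.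
Qed.

End ExpBounds.

(** * Independent coins *)

Section ProductLaws.
Variables (R : realFieldType) (I Y : finType).
Implicit Types (mu nu : I -> Y -> R) (Phi : {ffun I -> Y} -> R).
Implicit Types (f : {ffun I -> Y}) (i j : I) (y : Y).

Definition expect mu Phi : R :=
  \sum_(f : {ffun I -> Y}) (\prod_i mu i (f i)) * Phi f.

Definition law mu := (forall i y, 0 <= mu i y) /\ (forall i, \sum_y mu i y = 1).

Definition resample f j y : {ffun I -> Y} :=
  [ffun i => if i == j then y else f i].

Lemma expect_prod mu (F : I -> Y -> R) :
  expect mu (fun f => \prod_i F i (f i)) = \prod_i \sum_y mu i y * F i y.
Proof. by rewrite bigA_distr_bigA; apply: eq_bigr => f _; rewrite big_split. Qed.

Lemma expect_cst mu c : law mu -> expect mu (fun=> c) = c.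
Proof.
case=> _ mu1; rewrite /expect -mulr_suml -(bigA_distr_bigA mu).
by rewrite big1 ?mul1r// => i _; exact: mu1.
Qed.

Lemma ler_expect mu Phi Psi : law mu -> (forall f, Phi f <= Psi f) ->
  expect mu Phi <= expect mu Psi.
Proof.
case=> mu0 _ le; apply: ler_sum => f _; apply: ler_wpM2l => //.
by apply: prodr_ge0.
Qed.

Lemma expectD mu Phi Psi :
  expect mu (fun f => Phi f + Psi f) = expect mu Phi + expect mu Psi.
Proof. by rewrite /expect -big_split; apply: eq_bigr => f _; rewrite mulrDr. Qed.

Lemma expectB mu Phi Psi :
  expect mu (fun f => Phi f - Psi f) = expect mu Phi - expect mu Psi.
Proof. by rewrite /expect -sumrB; apply: eq_bigr => f _; rewrite mulrBr. Qed.

Lemma expect_sum mu (A : Type) (r : seq A) (S : pred A) (F : A -> {ffun I -> Y} -> R) :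
  expect mu (fun f => \sum_(a <- r | S a) F a f) =
  \sum_(a <- r | S a) expect mu (F a).
Proof.
rewrite /expect exchange_big/=; apply: eq_bigr => f _.
by rewrite mulr_sumr.
Qed.

(* Exchanging the coordinate [j] with the resampled value is an involution. *)
Lemma expect_resample mu nu j Phi :
  (forall i, i != j -> mu i = nu i) -> \sum_y mu j y = 1 ->
  expect nu Phi = expect mu (fun f => \sum_y nu j y * Phi (resample f j y)).
Proof.
move=> munu mu1.
transitivity (\sum_(fy : {ffun I -> Y} * Y)
    (\prod_i nu i (fy.1 i)) * Phi fy.1 * mu j fy.2).
  rewrite -(pair_bigA _ (fun f y => (\prod_i nu i (f i)) * Phi f * mu j y))/=.
  by apply: eq_bigr => f _; rewrite -mulr_sumr mu1 mulr1.
pose swap (fy : {ffun I -> Y} * Y) := (resample fy.1 j fy.2, fy.1 j).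
have swapK : involutive swap.
  case=> f y; rewrite /swap/= ffunE eqxx; congr (_, _).
  by apply/ffunP => i; rewrite !ffunE; case: eqP => // ->.
rewrite (reindex_inj (inv_inj swapK))/=.
rewrite -(pair_bigA _ (fun f y => (\prod_i nu i (resample f j y i))
  * Phi (resample f j y) * mu j (f j)))/=.
apply: eq_bigr => f _; rewrite mulr_sumr; apply: eq_bigr => y _.
rewrite (bigD1 j)//= [in RHS](bigD1 j)//= ffunE eqxx.
rewrite (eq_bigr (fun i => mu i (f i))); last first.
  by move=> i ij; rewrite ffunE (negbTE ij) munu.
ring.
Qed.

Lemma ler_expect_resample1 mu nu j Phi : law mu -> law nu ->
  (forall i, i != j -> mu i = nu i) ->
  (forall f, \sum_y mu j y * Phi (resample f j y) <=
             \sum_y nu j y * Phi (resample f j y)) ->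
  expect mu Phi <= expect nu Phi.
Proof.
move=> lmu lnu munu le.
rewrite (@expect_resample mu nu j)//; last exact: lmu.2.
rewrite {1}(@expect_resample mu mu j)//; last exact: lmu.2.
exact: ler_expect.
Qed.

(** A hybrid argument: the coordinates are switched from [mu] to [nu] one at a time, [mix s] being
    the law after those in [s] have been switched. *)
Lemma ler_expect_law mu nu Phi : law mu -> law nu ->
  (forall j f, \sum_y mu j y * Phi (resample f j y) <=
               \sum_y nu j y * Phi (resample f j y)) ->
  expect mu Phi <= expect nu Phi.
Proof.
move=> lmu lnu le.
pose mix (s : seq I) i := if i \in s then nu i else mu i.
have lmix s : law (mix s).
  case: lmu lnu => [mu0 mu1] [nu0 nu1].
  by rewrite /mix; split=> [i y|i]; case: ifP => _.
have mixle s : uniq s -> expect mu Phi <= expect (mix s) Phi.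
  elim: s => [_ //|j s IH /= /andP[js us]]; apply: (le_trans (IH us)).
  apply: (@ler_expect_resample1 _ _ j) => // [i ij|f].
    by rewrite /mix inE (negbTE ij).
  by rewrite /mix inE eqxx (negbTE js)/=; exact: le.
have := mixle _ (enum_uniq I); congr (_ <= _).
by apply: eq_bigr => f _; congr (_ * _); apply: eq_bigr => i _; rewrite /mix mem_enum.
Qed.

End ProductLaws.

Section Coins.
Variables (R : realFieldType) (T : finType).
Implicit Types (k : T -> R) (y : {ffun T -> bool}).

Definition coin (x : R) (b : bool) : R := if b then x else 1 - x.

Definition coin_row k y : R := \prod_t coin (k t) (y t).

Lemma coin_row_all k (S : pred T) :
  \sum_(y : {ffun T -> bool}) coin_row k y * [forall t, S t ==> y t]%:R = \prod_(t | S t) k t.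
Proof.
transitivity (\sum_(y : {ffun T -> bool}) \prod_t (coin (k t) (y t) * (S t ==> y t)%:R)).
  apply: eq_bigr => y _; rewrite big_split; congr (_ * _).
  case: forallP => [h|/forallP]; first by rewrite big1// => t _; rewrite h.
  by rewrite negb_forall => /existsP[t /negbTE St]; rewrite (bigD1 t)//= St mul0r.
rewrite -(bigA_distr_bigA (fun t b => coin (k t) b * (S t ==> b)%:R)).
rewrite [RHS]big_mkcond; apply: eq_bigr => t _.
by rewrite big_bool/=; case: (S t); rewrite /= ?mulr1 ?mulr0 ?addr0//; ring.
Qed.

Lemma coin_row_sum1 k : \sum_(y : {ffun T -> bool}) coin_row k y = 1.
Proof.
transitivity (\prod_(t | pred0 t) k t); last by rewrite big_pred0_eq.
rewrite -coin_row_all.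
apply: eq_bigr => y _; suff -> : [forall t, pred0 t ==> y t] by rewrite mulr1.
by apply/forallP.
Qed.

Lemma coin_row_ge0 k y : (forall t, 0 <= k t <= 1) -> 0 <= coin_row k y.
Proof.
move=> k01; apply: prodr_ge0 => t _; have /andP[k0 k1] := k01 t.
by rewrite /coin; case: ifP => // _; rewrite subr_ge0.
Qed.

Lemma coin_rows_law (I : finType) (k : I -> T -> R) :
  (forall i t, 0 <= k i t <= 1) -> law (fun i => coin_row (k i)).
Proof.
by move=> k01; split=> [i y|i]; [exact: coin_row_ge0|exact: coin_row_sum1].
Qed.

(** Currying groups the coins by index, so that all coins of one index form a single coordinate of a
    product law and can be replaced together. *)
Lemma coins_expect (I : finType) (k : I -> T -> R) (Phi : {ffun I * T -> bool} -> R) :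
  \sum_(omega : {ffun I * T -> bool})
     (\prod_c coin (k c.1 c.2) (omega c)) * Phi omega =
  expect (fun i => coin_row (k i))
    (fun f : {ffun I -> {ffun T -> bool}} => Phi [ffun c => f c.1 c.2]).
Proof.
pose uncur (f : {ffun I -> {ffun T -> bool}}) : {ffun I * T -> bool} :=
  [ffun c => f c.1 c.2].
pose cur (g : {ffun I * T -> bool}) : {ffun I -> {ffun T -> bool}} :=
  [ffun i => [ffun t => g (i, t)]].
rewrite (reindex uncur)/=; last first.
  exists cur => g _; first by apply/ffunP => i; apply/ffunP => t; rewrite !ffunE.
  by apply/ffunP => -[i t]; rewrite !ffunE.
apply: eq_bigr => f _; congr (_ * _).
transitivity (\prod_c coin (k c.1 c.2) (f c.1 c.2)).
  by apply: eq_bigr => c _; rewrite ffunE.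
by rewrite -(pair_bigA _ (fun i t => coin (k i t) (f i t))).
Qed.

End Coins.

(** * Survival of one index and extinction of a set of indices *)

Section Survival.
Variables (R : realFieldType) (N : nat).
Implicit Types (k : 'I_N -> R) (y : {ffun 'I_N -> bool}).
Implicit Types (f : {ffun 'I_N -> {ffun 'I_N -> bool}}) (J : pred 'I_N).

Definition alive y (j t : nat) : bool := [forall u : 'I_N, (j <= u <= t)%N ==> y u].

Definition surv k (j t : nat) : R := \prod_(u < N | (j <= u <= t)%N) k u.

(** Each index has its own test time [tau j], so that being extinct at [t] and having been so one
    step earlier range over the same indices. *)
Definition extinct J (tau : 'I_N -> nat) t f : bool :=
  [forall j, (J j && (j <= t)%N) ==> ~~ alive (f j) j (tau j)].

Definition some_extinct J a b f : bool :=
  has (fun t => extinct J (fun=> t) t f) (index_iota a b.+1).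

Lemma alive_le y j t t' : (t <= t')%N -> alive y j t' -> alive y j t.
Proof.
move=> tt' /forallP al; apply/forallP => u; apply/implyP => /andP[ju ut].
by apply: (implyP (al u)); rewrite ju (leq_trans ut).
Qed.

Lemma coin_row_dead k j t :
  \sum_(y : {ffun 'I_N -> bool}) coin_row k y * (~~ alive y j t)%:R = 1 - surv k j t.
Proof.
rewrite -[X in _ = X - _](coin_row_sum1 k) /surv -coin_row_all -sumrB.
apply: eq_bigr => y _; rewrite -/(alive y j t).
by case: alive; rewrite ?mulr1 ?mulr0 ?subrr ?subr0.
Qed.

(** Here [P t] stands for the extinction at [t] of all indices other than [j]. The event is certain
    if some such [t] does not involve [j], and impossible if there is no such [t]. Otherwise it says
    that [j] is dead at the last such time, because death is permanent. *)
Lemma coin_row_dead_le k k' (P : pred nat) (b j : nat) (c : bool) :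
  (forall t, P t -> (t <= b)%N) ->
  (forall t, P t -> c -> (j <= t)%N -> surv k' j t <= surv k j t) ->
  \sum_(y : {ffun 'I_N -> bool}) coin_row k y *
    (has (fun t => P t && ((c && (j <= t)%N) ==> ~~ alive y j t))
      (iota 0 b.+1))%:R <=
  \sum_(y : {ffun 'I_N -> bool}) coin_row k' y *
    (has (fun t => P t && ((c && (j <= t)%N) ==> ~~ alive y j t))
      (iota 0 b.+1))%:R.
Proof.
move=> Pb le; pose Phi y :=
  has (fun t => P t && ((c && (j <= t)%N) ==> ~~ alive y j t)) (iota 0 b.+1).
under eq_bigr do rewrite -/(Phi _).
under [leRHS]eq_bigr do rewrite -/(Phi _).
have cst d : (forall y, Phi y = d) ->
    \sum_(y : {ffun 'I_N -> bool}) coin_row k y * (Phi y)%:R <=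
    \sum_(y : {ffun 'I_N -> bool}) coin_row k' y * (Phi y)%:R.
  move=> Pd; under eq_bigr do rewrite Pd; under [leRHS]eq_bigr do rewrite Pd.
  by rewrite -!mulr_suml !coin_row_sum1.
have inb t : P t -> t \in iota 0 b.+1 by rewrite mem_iota ltnS => /Pb ->.
have [|] := boolP (has (fun t => P t && ~~ (c && (j <= t)%N)) (iota 0 b.+1)).
  case/hasP => t tb /andP[Pt nct]; apply: (cst true) => y.
  by apply/hasP; exists t; rewrite // Pt (negbTE nct).
move/hasPn => all_c; have {}all_c t : P t -> c && (j <= t)%N.
  by move=> Pt; have := all_c _ (inb _ Pt); rewrite Pt negbK.
have [|] := boolP (has P (iota 0 b.+1)); last first.
  move=> /hasPn nP; apply: (cst false) => y; apply/negbTE/hasPn => t /nP.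
  by move=> /negbTE ->.
case/hasP => t0 _ Pt0; have exP : exists t, P t by exists t0.
case: (ex_maxnP exP Pb) => tm Ptm maxtm.
have /andP[cT jtm] := all_c _ Ptm.
have PhiE y : Phi y = ~~ alive y j tm.
  apply/hasP/idP => [[t _ /andP[Pt]]|nal].
    by rewrite (all_c _ Pt)/=; apply/contra/alive_le/maxtm.
  by exists tm; [exact: inb|rewrite Ptm nal implybT].
under eq_bigr do rewrite PhiE; under [leRHS]eq_bigr do rewrite PhiE.
by rewrite !coin_row_dead lerD2l lerN2 le.
Qed.

(* The extinction probability is monotone in the survival functions alone: the
   coins of one index matter only through the last time at which that index
   could prevent an extinction. *)
Lemma ler_some_extinct (k k' : 'I_N -> 'I_N -> R) J a b :
  (forall i t, 0 <= k i t <= 1) -> (forall i t, 0 <= k' i t <= 1) ->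
  (forall (j : 'I_N) t, J j -> (j <= t <= b)%N ->
     surv (k' j) j t <= surv (k j) j t) ->
  expect (fun i => coin_row (k i)) (fun f => (some_extinct J a b f)%:R) <=
  expect (fun i => coin_row (k' i)) (fun f => (some_extinct J a b f)%:R).
Proof.
move=> k01 k'01 le; apply: ler_expect_law; try exact: coin_rows_law.
move=> j f.
pose P t := [&& (a <= t)%N, (t <= b)%N &
  [forall i, [&& i != j, J i & (i <= t)%N] ==> ~~ alive (f i) i t]].
have E y : some_extinct J a b (resample f j y) =
    has (fun t => P t && ((J j && (j <= t)%N) ==> ~~ alive y j t)) (iota 0 b.+1).
  apply/hasP/hasP => -[t].
    rewrite mem_index_iota ltnS => /andP[at_ tb] /forallP ex; exists t.
      by rewrite mem_iota.
    apply/andP; split; last by have := ex j; rewrite ffunE eqxx.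
    rewrite /P at_ tb/=; apply/forallP => i; apply/implyP => /and3P[ij Ji it].
    by have := ex i; rewrite ffunE (negbTE ij) Ji it.
  move=> _ /andP[/and3P[at_ tb /forallP ex] exj]; exists t.
    by rewrite mem_index_iota at_.
  apply/forallP => i; rewrite ffunE; case: eqP => [->//|/eqP ij].
  by have := ex i; rewrite ij.
under eq_bigr do rewrite E; under [leRHS]eq_bigr do rewrite E.
apply: coin_row_dead_le => [t /and3P[]//|t /and3P[_ tb _] Jj jt].
by apply: le => //; rewrite jt.
Qed.

Lemma expect_extinct (k : 'I_N -> 'I_N -> R) J tau t :
  expect (fun i => coin_row (k i)) (fun f => (extinct J tau t f)%:R) =
  \prod_(j < N | J j && (j <= t)%N) (1 - surv (k j) j (tau j)).
Proof.
rewrite [RHS]big_mkcond/=.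
transitivity (\prod_j \sum_(y : {ffun 'I_N -> bool}) coin_row (k j) y *
    ((J j && (j <= t)%N) ==> ~~ alive y j (tau j))%:R).
  rewrite -expect_prod; apply: eq_bigr => f _; congr (_ * _).
  rewrite /extinct; case: forallP => [h|/forallP]; first by rewrite big1// => j _; rewrite h.
  by rewrite negb_forall => /existsP[j /negbTE nj]; rewrite (bigD1 j)//= nj mul0r.
apply: eq_bigr => j _; case: ifP => _ /=; first exact: coin_row_dead.
by rewrite -mulr_suml coin_row_sum1 mul1r.
Qed.

(** A union bound over new extinctions only: the subtracted event, where every index was dead at
    [t.-1] already, implies extinction at both [t] and [t.-1]. The index [t] itself cannot be tested
    at [t.-1], hence the [maxn]. *)
Lemma some_extinct_le J a b f : (a <= b)%N ->
  (some_extinct J a b f)%:R <= (extinct J (fun=> a) a f)%:R +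
    \sum_(a.+1 <= t < b.+1) ((extinct J (fun=> t) t f)%:R
       - (extinct J (fun j => maxn j t.-1) t f)%:R) :> R.
Proof.
elim: b => [|b IH].
  by rewrite leqn0 => /eqP ->; rewrite /some_extinct/= orbF big_geq ?addr0.
rewrite leq_eqVlt => /orP[/eqP ->|ab].
  by rewrite /some_extinct /index_iota subSnn/= orbF big_geq ?addr0.
rewrite big_nat_recr//= addrA; apply: le_trans (lerD (IH ab) (lexx _)).
have -> : some_extinct J a b.+1 f =
    some_extinct J a b f || extinct J (fun=> b.+1) b.+1 f.
  rewrite /some_extinct /index_iota subSn; last exact: leqW.
  by rewrite -addn1 iotaD has_cat/= orbF subnKC// leqW.
set e2 := extinct J (fun j => maxn j b) b.+1 f.
have e21 : e2 -> extinct J (fun=> b.+1) b.+1 f.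
  move=> /forallP h; apply/forallP => j; apply/implyP => Jj.
  have := h j; rewrite Jj/=; apply/contra/alive_le.
  by case/andP: Jj => _ jb; rewrite geq_max jb leqnSn.
have e2s : e2 -> some_extinct J a b f.
  move=> /forallP h; apply/hasP; exists b; first by rewrite mem_index_iota ltnSn -ltnS ab.
  apply/forallP => j; apply/implyP => /andP[Jj jb].
  by have := h j; rewrite Jj leqW//= (maxn_idPr jb).
case: e2 e21 e2s => [/(_ isT)-> /(_ isT)->|_ _] /=; first by lra.
by case: some_extinct; case: extinct => /=; lra.
Qed.

End Survival.

(** * Extinction probabilities *)

Section ProductDifference.
Variables (R : realType) (I : finType) (P : pred I).
Implicit Types (x y c L : I -> R).

Lemma prod_compl_le_expR (r : seq I) y : (forall i, P i -> y i <= 1) ->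
  \prod_(i <- r | P i) (1 - y i) <= expR (- \sum_(i <- r | P i) y i).
Proof.
move=> y1; rewrite -sumrN expR_sum; apply: ler_prod => i Pi.
by rewrite subr_ge0 y1// expR_ge1Dx.
Qed.

(** Changing the factors one by one leaves products with one factor missing. The other factors are
    bounded by exponentials, and the missing one costs at most [expR (y i) <= expR 1]. *)
Lemma prod_compl_diff_le (r : seq I) x y :
  (forall i, P i -> [/\ 0 <= y i, y i <= x i & x i <= 1]) ->
  \prod_(i <- r | P i) (1 - y i) - \prod_(i <- r | P i) (1 - x i) <=
  expR (1 - \sum_(i <- r | P i) y i) * \sum_(i <- r | P i) (x i - y i).
Proof.
move=> yx; elim: r => [|i r IH]; first by rewrite !big_nil subrr mulr0.
rewrite !big_cons; case: ifP => // Pi; have [y0 yxi x1] := yx i Pi.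
have y1 j : P j -> y j <= 1 by move=> /yx[_ yxj]; exact: le_trans.
have := prod_compl_le_expR r y1; move: IH.
have : \prod_(j <- r | P j) (1 - x j) <= \prod_(j <- r | P j) (1 - y j).
  by apply: ler_prod => j /yx[? ? ?]; rewrite subr_ge0 lerD2l lerN2; apply/andP.
set A := \prod_(j <- r | P j) (1 - y j); set B := \prod_(j <- r | P j) (1 - x j).
set Y := \sum_(j <- r | P j) y j; set D := \sum_(j <- r | P j) (x j - y j).
move=> BA AB AY.
have D0 : 0 <= D by apply: sumr_ge0 => j /yx[_ ? _]; rewrite subr_ge0.
have E : expR (1 - (y i + Y)) = expR (- y i) * expR (1 - Y).
  by rewrite -expRD; congr expR; ring.
have E1 : expR (- Y) <= expR (1 - (y i + Y)).
  by rewrite ler_expR; have := y1 i Pi; lra.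
have le1 : (1 - y i) * (A - B) <= expR (1 - (y i + Y)) * D.
  by rewrite E -mulrA; apply: ler_pM; rewrite ?subr_ge0 ?y1 ?expR_ge1Dx.
have le2 : (x i - y i) * B <= (x i - y i) * expR (1 - (y i + Y)).
  apply: ler_wpM2l; first by rewrite subr_ge0.
  exact: le_trans BA (le_trans AY E1).
rewrite mulrDr; lra.
Qed.

(* Jensen's inequality for the function [x * exp (- x)], convex for [2 <= x]. *)
Lemma sum_mul_expRN_ge c L : (forall i, P i -> 0 <= c i) ->
  (forall i, P i -> 2 <= L i) -> 1 <= \sum_(i | P i) c i ->
  (\sum_(i | P i) c i * L i) * expR (- \sum_(i | P i) c i * L i) <=
  \sum_(i | P i) c i * L i * expR (- L i).
Proof.
move=> c0 L2 C1; set Z := \sum_(i | P i) c i * L i; set C := \sum_(i | P i) c i in C1.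
have C0 : 0 < C by lra.
have ZC : 2 * C <= Z.
  rewrite /Z /C mulr_sumr; apply: ler_sum => i Pi.
  by rewrite mulrC; apply: ler_wpM2l; [exact: c0|exact: L2].
(* The weights have total [C >= 1] instead of 1; replacing [expR (- (C * m))] by the larger
   [expR (- m)] reduces to the weighted mean [m]. *)
pose m := Z / C.
have ZE : Z = C * m by rewrite /m mulrCA mulfV ?mulr1// gt_eqF.
have m2 : 2 <= m by rewrite /m ler_pdivlMr.
apply: (@le_trans _ _ (C * (m * expR (- m)))).
  rewrite {1}ZE -mulrA; apply: ler_wpM2l; first exact: ltW.
  by apply: ler_wpM2l; [lra|rewrite ler_expR ZE; nra].
have -> : C * (m * expR (- m)) = \sum_(i | P i)
    c i * (m * expR (- m) + (1 - m) * expR (- m) * (L i - m)).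
  transitivity (\sum_(i | P i) (c i * (m * expR (- m) - (1 - m) * expR (- m) * m)
      + c i * L i * ((1 - m) * expR (- m)))).
    by rewrite big_split/= -!mulr_suml -/C -/Z ZE; ring.
  by apply: eq_bigr => i _; ring.
apply: ler_sum => i Pi; rewrite -[leRHS]mulrA; apply: ler_wpM2l; first exact: c0.
by apply: mulr_expRN_tangent => //; exact: L2.
Qed.

(** When no minimum is clipped, the [z] are linear, so the difference of products carries a factor
    [Z * expR (- Z)], to which Jensen's inequality applies. When one is clipped at [v], the second
    product vanishes, and [v] can be lowered to the point where clipping begins. *)
Lemma prod_compl_min_diff_le c L (u v : R) : 0 < u -> u <= v ->
  (forall i, P i -> 0 < c i) -> (forall i, P i -> 2 <= L i) ->
  1 <= \sum_(i | P i) c i * u ->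
  \prod_(i | P i) (1 - Num.min 1 (c i * L i * u)) -
    \prod_(i | P i) (1 - Num.min 1 (c i * L i * v)) <=
  expR 1 * \sum_(i | P i) expR (- L i) *
    (Num.min 1 (c i * L i * v) - Num.min 1 (c i * L i * u)).
Proof.
move=> u0 uv c0 L2 C1; pose z w i := Num.min 1 (c i * L i * w).
suff: \prod_(i | P i) (1 - z u i) - \prod_(i | P i) (1 - z v i) <=
  expR 1 * \sum_(i | P i) expR (- L i) * (z v i - z u i) by [].
have k0 i : P i -> 0 < c i * L i.
  by move=> Pi; apply: mulr_gt0; [exact: c0|have := L2 _ Pi; lra].
have z1 w i : z w i <= 1 by rewrite ge_min lexx.
have zuv w w' i : P i -> w <= w' -> z w i <= z w' i.
  move=> Pi ww'; rewrite /z le_min ge_min lexx/= ge_min.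
  by apply/orP; right; apply: ler_wpM2l => //; exact/ltW/k0.
have rhs0 w : u <= w -> 0 <= expR 1 * \sum_(i | P i) expR (- L i) * (z w i - z u i).
  move=> uw; apply: mulr_ge0; first exact: expR_ge0.
  by apply: sumr_ge0 => i Pi; rewrite mulr_ge0 ?expR_ge0// subr_ge0 zuv.
have rhsv w : w <= v -> expR 1 * \sum_(i | P i) expR (- L i) * (z w i - z u i) <=
    expR 1 * \sum_(i | P i) expR (- L i) * (z v i - z u i).
  move=> wv; apply: ler_wpM2l; first exact: expR_ge0.
  apply: ler_sum => i Pi; apply: ler_wpM2l; first exact: expR_ge0.
  by rewrite lerD2r zuv.
have linear w : u <= w -> (forall i, P i -> c i * L i * w <= 1) ->
    \prod_(i | P i) (1 - z u i) - \prod_(i | P i) (1 - z w i) <=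
    expR 1 * \sum_(i | P i) expR (- L i) * (z w i - z u i).
  move=> uw k1.
  have zE w' i : P i -> w' <= w -> z w' i = c i * L i * w'.
    move=> Pi w'w; apply/min_idPr; apply: le_trans (k1 _ Pi).
    by apply: ler_wpM2l => //; exact/ltW/k0.
  apply: (le_trans (@prod_compl_diff_le _ (z w) (z u) _)).
    move=> i Pi; split; [|exact: zuv|exact: z1].
    by rewrite zE// mulr_ge0 ?ltW// k0.
  rewrite expRD -mulrA; apply: ler_wpM2l; first exact: expR_ge0.
  have ZE : \sum_(i | P i) z u i = \sum_(i | P i) (c i * u) * L i.
    by apply: eq_bigr => i Pi; rewrite zE// mulrAC.
  have := @sum_mul_expRN_ge (fun i => c i * u) L _ L2 C1.
  rewrite -ZE /= => /(_ (fun i Pi => mulr_ge0 (ltW (c0 i Pi)) (ltW u0))) jensen.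
  have DE : \sum_(i | P i) (z w i - z u i) = (w - u) / u * \sum_(i | P i) z u i.
    rewrite mulr_sumr; apply: eq_bigr => i Pi; rewrite !zE//.
    by field; rewrite gt_eqF.
  rewrite DE mulrCA [X in _ * X]mulrC.
  apply: (@le_trans _ _ ((w - u) / u * \sum_(i | P i) c i * u * L i * expR (- L i))).
    by apply: ler_wpM2l => //; apply: divr_ge0; lra.
  rewrite mulr_sumr; apply: ler_sum => i Pi; rewrite !zE//.
  by rewrite le_eqVlt; apply/orP; left; apply/eqP; field; rewrite gt_eqF.
have [/forall_inP small|] := boolP [forall (i | P i), c i * L i * v <= 1].
  exact: linear.
rewrite negb_forall_in => /exists_inP[i0 Pi0]; rewrite -ltNge => big0.
have zvi0 : z v i0 = 1 by apply/min_idPl/ltW.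
have prodv0 : \prod_(i | P i) (1 - z v i) = 0 by rewrite (bigD1 i0)//= zvi0 subrr mul0r.
rewrite prodv0 subr0.
case: (@arg_maxP _ _ _ i0 P (fun i => c i * L i) Pi0) => im Pim maxim.
(* The smallest argument at which some factor vanishes: up to [w] all [z] are linear, and at [w] the
   product is already 0. *)
pose w := (c im * L im)^-1.
have km0 := k0 _ Pim.
have [wu|uw] := leP w u.
  have -> : \prod_(i | P i) (1 - z u i) = 0.
    rewrite (bigD1 im)//= (_ : z u im = 1) ?subrr ?mul0r//.
    by apply/min_idPl; rewrite -ler_pdivrMl// mulr1.
  exact: rhs0.
have wv : w <= v.
  rewrite /w -[_^-1]mulr1 ler_pdivrMl// ltW//; apply: lt_le_trans big0 _.
  by apply: ler_wpM2r; [lra|exact: maxim].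
apply: le_trans (rhsv _ wv).
have := linear w (ltW uw); rewrite (_ : \prod_(i | P i) (1 - z w i) = 0) ?subr0.
  apply=> i Pi; rewrite -ler_pdivlMr ?invr_gt0// invrK mul1r; exact: maxim.
rewrite (bigD1 im)//= (_ : z w im = 1) ?subrr ?mul0r//.
by rewrite /z /w mulfV ?minxx// gt_eqF.
Qed.

End ProductDifference.

Lemma surv_id (R : realFieldType) (N : nat) (k : 'I_N -> R) (j : 'I_N) :
  surv k j j = k j.
Proof.
by rewrite /surv (big_pred1 j)// => u; rewrite /= -eqn_leq eq_sym.
Qed.

Lemma survS (R : realFieldType) (N : nat) (k : 'I_N -> R) (j t : nat)
    (tN : (t.+1 < N)%N) : (j <= t.+1)%N ->
  surv k j t.+1 = surv k j t * k (Ordinal tN).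
Proof.
move=> jt; rewrite /surv (bigD1 (Ordinal tN)) ?jt//= mulrC; congr (_ * _).
by apply: eq_bigl => u; rewrite -val_eqE/=; lia.
Qed.

Section ExtinctionBound.
Variables (R : realType) (N a b : nat) (J : pred 'I_N) (c L : 'I_N -> R).
Variables (V : nat -> R) (k : 'I_N -> 'I_N -> R).
Hypotheses (ab : (a <= b)%N) (bN : (b < N)%N).
Hypothesis J_ge : forall j, J j -> (a <= j)%N.
Hypothesis c_gt0 : forall j, J j -> 0 < c j.
Hypothesis L_ge2 : forall j, J j -> 2 <= L j.
Hypothesis V_gt0 : forall t, (a <= t <= b)%N -> 0 < V t.
Hypothesis V_nd : forall t, (a <= t < b)%N -> V t <= V t.+1.
Hypothesis V_le : forall t, (a <= t <= b)%N ->
  V t <= \sum_(j | J j && (j <= t)%N) c j.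
Hypothesis k01 : forall i t, 0 <= k i t <= 1.

Let z t j := Num.min 1 (c j * L j * (V t)^-1).

Hypothesis k_ge : forall (j : 'I_N) t, J j -> (j <= t <= b)%N ->
  z t j <= surv (k j) j t.

(** Coins whose survival probabilities are exactly the lower bounds [z]; the ratios are at most 1
    because [V] is nondecreasing. *)
Let k' (j u : 'I_N) : R :=
  if J j && (j <= u <= b)%N then
    if u == j then z j j else z u j / z u.-1 j
  else 1.

Let cL_gt0 j : J j -> 0 < c j * L j.
Proof. by move=> Jj; apply: mulr_gt0; [exact: c_gt0|have := L_ge2 Jj; lra]. Qed.

Let z_gt0 t j : J j -> (a <= t <= b)%N -> 0 < z t j.
Proof.
move=> Jj tab; rewrite /z lt_min ltr01/= mulr_gt0 ?invr_gt0 ?V_gt0//.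
exact: cL_gt0.
Qed.

Let z_le1 t j : z t j <= 1. Proof. by rewrite /z ge_min lexx. Qed.

Let z_ni t j : J j -> (a <= t < b)%N -> z t.+1 j <= z t j.
Proof.
move=> Jj /andP[at_ tb]; rewrite /z le_min ge_min lexx/= ge_min; apply/orP; right.
apply: ler_wpM2l; first exact/ltW/cL_gt0.
rewrite lef_pV2 ?posrE ?V_nd ?at_//; apply: V_gt0; lia.
Qed.

Let k'01 i t : 0 <= k' i t <= 1.
Proof.
rewrite /k'; case: ifP => [/andP[Ji /andP[it tb]]|_]; last by rewrite lexx ler01.
have ai := J_ge Ji.
case: eqP => [_|/eqP ti]; first by rewrite z_le1 ltW// z_gt0//; lia.
have it1 : (i < t)%N by rewrite ltn_neqAle it andbT eq_sym.
have zt1 : 0 < z t.-1 i by apply: z_gt0 => //; lia.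
have := @z_ni t.-1 i Ji; rewrite prednK; last by lia.
move=> h; rewrite ler_pdivrMr// mul1r h ?andbT; last by lia.
by apply: divr_ge0; apply: ltW => //; apply: z_gt0 => //; lia.
Qed.

Let surv_k' (j : 'I_N) t : J j -> (j <= t <= b)%N -> surv (k' j) j t = z t j.
Proof.
move=> Jj /andP[]; have aj := J_ge Jj.
have diag : (j <= b)%N -> surv (k' j) j j = z j j.
  by move=> jb; rewrite surv_id /k' Jj leqnn jb eqxx.
elim: t => [|t IH] jt tb.
  by move: diag jt; rewrite leqn0 => diag /eqP j0; rewrite -j0 in tb *; exact: diag.
move: jt; rewrite leq_eqVlt => /orP[/eqP jt|jt].
  by rewrite -jt in tb *; exact: diag.
have tN : (t.+1 < N)%N by lia.
rewrite (survS _ tN) ?IH ?leqW//; try lia.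
rewrite /k' Jj/= leqW ?tb// -val_eqE/= gtn_eqF//.
by rewrite mulrC divfK// gt_eqF// z_gt0//; lia.
Qed.

Lemma extinction_prob_le :
  expect (fun i => coin_row (k i)) (fun f => (some_extinct J a b f)%:R) <=
  expR 1 * \sum_(j | J j) expR (- L j).
Proof.
apply: (@le_trans _ _ (expect (fun i => coin_row (k' i))
    (fun f => (some_extinct J a b f)%:R))).
  by apply: ler_some_extinct => // j t Jj jtb; rewrite surv_k'//; exact: k_ge.
apply: (le_trans (ler_expect (coin_rows_law k'01) (fun f => some_extinct_le R J f ab))).
rewrite expectD expect_sum.
(* At time [a] the only index of [J] present is [a] itself, with [V a <= c a] and [L a >= 2]: it is
   clipped to survival probability 1. *)
have start0 : expect (fun i => coin_row (k' i))
    (fun f => (extinct J (fun=> a) a f)%:R) = 0.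
  rewrite expect_extinct.
  have Va : 0 < V a by apply: V_gt0; rewrite leqnn.
  have Vc : V a <= \sum_(j | J j && (j <= a)%N) c j by apply: V_le; rewrite leqnn.
  have [j0 /andP[Jj0 j0a]|none] := pickP (fun j => J j && (j <= a)%N); last first.
    by move: Vc; rewrite big_pred0//; lra.
  have j0E : j0 = a :> nat by have := J_ge Jj0; lia.
  have uniq_j j : J j && (j <= a)%N = (j == j0).
    apply/andP/eqP => [[Jj ja]|->//]; apply: val_inj => /=.
    by have := J_ge Jj; lia.
  rewrite (big_pred1 j0)//= -j0E surv_k' ?leqnn//=; last by lia.
  apply/eqP; rewrite subr_eq0 eq_sym; apply/eqP/min_idPl.
  rewrite j0E ler_pdivlMr// mul1r.
  move: Vc; rewrite (big_pred1 j0)// => Vc; have := L_ge2 Jj0; nra.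
rewrite start0 add0r.
apply: (@le_trans _ _ (\sum_(a.+1 <= t < b.+1)
    expR 1 * \sum_(j | J j) expR (- L j) * (z t.-1 j - z t j))).
  rewrite big_nat_cond [leRHS]big_nat_cond; apply: ler_sum => t.
  rewrite andbT => /andP[at_ tb].
  have zt j : J j -> z t j <= z t.-1 j.
    move=> Jj; have := @z_ni t.-1 j Jj; rewrite prednK; last by lia.
    by apply; lia.
  rewrite expectB !expect_extinct.
  have -> : \prod_(j < N | J j && (j <= t)%N) (1 - surv (k' j) j t) =
      \prod_(j < N | J j && (j <= t)%N) (1 - z t j).
    by apply: eq_bigr => j /andP[Jj jt]; rewrite surv_k'// jt -ltnS tb.
  (* For [j = t] the value [z t.-1 j] is purely formal. It is at least [z t j], so using it only
     lowers the subtracted product. *)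
  have le1 : \prod_(j < N | J j && (j <= t)%N) (1 - z t.-1 j) <=
      \prod_(j < N | J j && (j <= t)%N) (1 - surv (k' j) j (maxn j t.-1)).
    apply: ler_prod => j /andP[Jj jt]; rewrite subr_ge0 z_le1/= lerD2l lerN2.
    rewrite surv_k' ?leq_maxl//=; last by lia.
    have [jt1|jt1] := leqP j t.-1; first by [].
    have -> : nat_of_ord j = t by lia.
    exact: zt.
  apply: (@le_trans _ _ (\prod_(j < N | J j && (j <= t)%N) (1 - z t j) -
      \prod_(j < N | J j && (j <= t)%N) (1 - z t.-1 j))).
    by rewrite lerD2l lerN2.
  have VVt : V t.-1 <= V t.
    by have := @V_nd t.-1; rewrite prednK; last (by lia); apply; lia.
  have Vt : 0 < V t by apply: V_gt0; lia.
  have Vt1 : 0 < V t.-1 by apply: V_gt0; lia.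
  apply: le_trans (@prod_compl_min_diff_le R 'I_N (fun j => J j && (j <= t)%N) c L
    (V t)^-1 (V t.-1)^-1 _ _ _ _ _) _.
  - by rewrite invr_gt0.
  - by rewrite lef_pV2.
  - by move=> j /andP[/c_gt0].
  - by move=> j /andP[/L_ge2].
  - by rewrite -mulr_suml ler_pdivlMr// mul1r; apply: V_le; lia.
  apply: ler_wpM2l; first exact: expR_ge0.
  (* Indices beyond [t] add nonnegative terms; with them the range of [j] no longer depends on [t],
     and each [j] telescopes over [t]. *)
  rewrite [leRHS](bigID (fun j : 'I_N => (j <= t)%N))/= lerDl.
  by apply: sumr_ge0 => j /andP[Jj _]; rewrite mulr_ge0 ?expR_ge0// subr_ge0 zt.
rewrite -mulr_sumr; apply: ler_wpM2l; first exact: expR_ge0.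
rewrite exchange_big/=; apply: ler_sum => j Jj.
rewrite -mulr_sumr -[leRHS]mulr1; apply: ler_wpM2l; first exact: expR_ge0.
rewrite big_add1/= (eq_bigr (fun t => - (z t.+1 j - z t j))); last first.
  by move=> t _; rewrite opprB.
rewrite sumrN telescope_sumr// opprB.
have := z_le1 a j; have : 0 < z b j by apply: z_gt0 => //; rewrite ab leqnn.
lra.
Qed.

End ExtinctionBound.

(** * Runs of the algorithm *)

Lemma bigminn_le (I : finType) (x : nat) (S : pred I) (F : I -> nat) i :
  S i -> (\big[minn/x]_(j | S j) F j <= F i)%N.
Proof. by move=> Si; rewrite -minEnat -leEnat; exact: bigmin_le_cond. Qed.

Lemma bigminn_attained (I : finType) (x : nat) (S : pred I) (F : I -> nat) :
  \big[minn/x]_(j | S j) F j = x \/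
  exists2 i, S i & \big[minn/x]_(j | S j) F j = F i.
Proof.
elim/big_rec: _ => [|i y Si IH]; first by left.
have [_|_] := leqP (F i) y; first by right; exists i.
by case: IH => [|[j Sj]] ->; [left|right; exists j].
Qed.

Lemma pairwise_ltn_ordP (n : nat) (e : rel 'I_n) (s : seq 'I_n) :
  pairwise (fun i j : 'I_n => i < j)%N s ->
  reflect {in s &, forall i j : 'I_n, (i < j)%N -> e i j} (pairwise e s).
Proof.
elim: s => [|i s IH] /=; first by left.
case/andP => /allP lti /IH{}IH; apply: (iffP andP) => [[/allP ei /IH es] x y|h].
  rewrite !inE => /orP[/eqP ->|xs] /orP[/eqP ->|ys] xy.
  - by rewrite ltnn in xy.
  - exact: ei.
  - by have := lti _ xs; rewrite ltnNge ltnW.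
  - exact: es.
split; first by apply/allP => j js; apply: h; rewrite ?inE ?eqxx ?js ?orbT ?lti.
by apply/IH => x y xs ys; apply: h; rewrite inE ?xs ?ys orbT.
Qed.

(** Transitivity turns the condition on consecutive indices into one on all pairs, which no longer
    mentions the enumeration. *)
Lemma sigma_pathP (P : Type) (prec : rel P) (n : nat) (sigma : 'I_n -> P)
    (S : {set 'I_n}) : transitive prec ->
  reflect {in S &, forall i j : 'I_n, (i < j)%N -> prec (sigma i) (sigma j)}
    (sigma_path prec sigma S).
Proof.
move=> tr; rewrite /sigma_path sorted_pairwise; last first.
  by move=> i j k; exact: tr.
have lt_enum : pairwise (fun i j : 'I_n => i < j)%N (enum S).
  rewrite -(pairwise_map val ltn) -sorted_pairwise; last exact: ltn_trans.
  rewrite [enum _](_ : _ = [seq j <- enum 'I_n | j \in S]); last first.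
    by rewrite enumT.
  apply: (subseq_sorted ltn_trans (map_subseq _ (filter_subseq _ _))).
  by rewrite val_enum_ord iota_ltn_sorted.
apply: (iffP (pairwise_ltn_ordP _ lt_enum)) => h x y xS yS;
  by apply: h; rewrite ?mem_enum// -mem_enum.
Qed.

Section Weights.
Variables (n : nat) (w : 'I_n -> nat).

Lemma input_pos_ord (j : 'I_n) : input_pos n j.+1 = Some j.
Proof. by rewrite /input_pos; case: insubP => [i _ /val_inj ->//|]; rewrite ltn_ord. Qed.

Lemma input_posP t j : input_pos n t = Some j -> t = j.+1.
Proof. by case: t => //= t; case: insubP => // i _ <- [<-]. Qed.

Lemma W0 : W w 0 = 0%N. Proof. by rewrite /W big_geq. Qed.

Lemma WS t : W w t.+1 = (W w t + wt w t.+1)%N.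
Proof. by rewrite /W big_nat_recr. Qed.

Lemma leq_W s t : (s <= t)%N -> (W w s <= W w t)%N.
Proof.
move=> /subnK <-; elim: (t - s)%N => [//|d IH].
by rewrite addSn WS; apply: leq_trans IH (leq_addr _ _).
Qed.

Lemma sum_input_pos (F : nat -> nat) (S : pred 'I_n) t : (t <= n)%N ->
  (\sum_(1 <= u < t.+1 | if input_pos n u is Some j then S j else false) F u =
   \sum_(j < n | (j < t)%N && S j) F j.+1)%N.
Proof.
move=> tn; rewrite big_add1/= big_mkord.
rewrite (big_ord_widen_cond n (fun u => if input_pos n u.+1 is Some j then S j else false)
  (fun u => F u.+1) tn).
by apply: eq_bigl => j; rewrite input_pos_ord andbC.
Qed.

Lemma W_total : W w n = total_weight w.
Proof.
rewrite /total_weight /W big_nat_cond.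
rewrite (eq_bigl (fun u => (1 <= u < n.+1)%N && true)); last by move=> u; rewrite andbT.
rewrite -big_nat_cond big_add1/= big_mkord.
by apply: eq_bigr => j _; rewrite /wt input_pos_ord.
Qed.

End Weights.

Section Run.
Variables (P : Type) (prec : rel P) (n : nat) (sigma : 'I_n -> P) (w : 'I_n -> nat).
Variable omega : coins n.

Definition coins_row (i : 'I_n.+2) : {ffun 'I_n.+2 -> bool} :=
  [ffun u => omega (i, u)].

Definition kept (i t : nat) : bool := alive (coins_row (inord i)) i t.

Let st := run prec sigma w omega.

Definition run_dist (t : nat) : nat := dist (st t) (inord t).

Lemma kept_diag i : (i <= n.+1)%N -> kept i i = omega (inord i, inord i).
Proof.
move=> iN; apply/forallP/idP => [/(_ (inord i))|oi u].
  by rewrite inordK// leqnn ffunE.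
by apply/implyP; rewrite -eqn_leq ffunE => /eqP iu; rewrite iu inord_val in oi *.
Qed.

Lemma keptS i t : (i <= t)%N -> (t < n.+1)%N ->
  kept i t.+1 = kept i t && omega (inord i, inord t.+1).
Proof.
move=> it tn; apply/idP/andP => [al|[/forallP al oi]].
  split; first exact: alive_le al.
  by have /forallP/(_ (inord t.+1)) := al; rewrite inordK// leqnn (leqW it) ffunE.
apply/forallP => u; apply/implyP => /andP[iu]; rewrite leq_eqVlt => /orP[/eqP ut|ut].
  by rewrite ffunE -[u]inord_val ut.
by apply: (implyP (al u)); rewrite iu.
Qed.

(** Membership of an index depends on its own coins only, never on the computed distances. This
    makes different indices independent. *)
Lemma mem_run t (i : 'I_n.+2) : (t <= n.+1)%N ->
  (i \in memory (st t)) = (i == ord0) || [&& (0 < i)%N, (i <= t)%N & kept i t].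
Proof.
elim: t => [_|t IH tn].
  by rewrite inE leqn0 lt0n; case: (i == ord0) => //; rewrite andbA andNb.
rewrite /st /= -/st !inE IH ?(ltnW tn)//.
case: (altP (i =P ord0)) => [_|/eqP i0] /=; first by rewrite orbT.
have i_gt0 : (0 < i)%N by rewrite lt0n; apply/eqP => i0'; apply: i0; exact: val_inj.
rewrite i_gt0/= -val_eqE/= inordK//.
have [it|it|it] := ltngtP (i : nat) t.+1 => /=.
- by rewrite -ltnS it keptS// inord_val.
- by rewrite leqNgt ltnW.
- by rewrite -it kept_diag ?inord_val// -ltnS.
Qed.

Lemma run_distS t : (t <= n)%N ->
  run_dist t.+1 = new_dist prec sigma w (st t) (inord t.+1).
Proof. by move=> tn; rewrite /run_dist /st/= eqxx. Qed.

Lemma dist_run t (i : 'I_n.+2) : (i <= t)%N -> (t <= n.+1)%N ->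
  dist (st t) i = run_dist i.
Proof.
elim: t => [|t IH]; first by rewrite leqn0 => /eqP -> _.
move=> it tn; rewrite /st /= -/st -val_eqE/= inordK//.
case: eqP => [iE|/eqP it']; last by rewrite IH ?(ltnW tn)//; lia.
by rewrite iE run_distS.
Qed.

Lemma candidate_run t (i : 'I_n.+2) : (i <= t)%N -> (t <= n)%N ->
  candidate w (st t) (inord t.+1) i = (run_dist i + (W w t - W w i))%N.
Proof. by move=> it tn; rewrite /candidate dist_run ?inordK// leqW. Qed.

Lemma run_dist_le t i : (t <= n)%N -> (i <= t)%N -> (i == 0)%N || kept i t ->
  arrow prec sigma i t.+1 -> (run_dist t.+1 <= run_dist i + (W w t - W w i))%N.
Proof.
move=> tn it ki ar; have iK : (inord i : 'I_n.+2) = i :> nat by rewrite inordK//; lia.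
rewrite run_distS// -{1 2}iK -candidate_run ?iK//; apply: bigminn_le.
rewrite iK inordK// ar andbT mem_run ?(leqW tn)// -val_eqE/= iK it.
by case/orP: ki => -> //; rewrite /= !andbT lt0n orbN.
Qed.

Lemma run_dist_attained t : (t <= n)%N -> exists i : nat,
  [/\ (i <= t)%N, arrow prec sigma i t.+1 &
      run_dist t.+1 = (run_dist i + (W w t - W w i))%N].
Proof.
move=> tn; rewrite run_distS// /new_dist.
case: (bigminn_attained (candidate w (st t) (inord t.+1) ord0)
  (fun i => (i \in memory (st t)) && arrow prec sigma i (inord t.+1 : 'I_n.+2))
  (candidate w (st t) (inord t.+1))) => [->|[i /andP[im ar] ->]].
  by exists 0%N; rewrite candidate_run.
have it : (i <= t)%N.
  by move: im; rewrite mem_run ?leqW//; case/orP => [/eqP ->//|/and3P[]].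
by exists i; rewrite candidate_run//; split=> //; rewrite inordK in ar.
Qed.

(** Following the minimizers backwards yields a path ending before [t]; [run_dist t] is the weight
    it misses among the positions before [t]. *)
Lemma run_dist_path t : transitive prec -> (t <= n.+1)%N ->
  exists S : {set 'I_n}, [/\ sigma_path prec sigma S,
    {in S, forall i : 'I_n, arrow prec sigma i.+1 t} &
    W w t.-1 = (\sum_(j in S) w j + run_dist t)%N].
Proof.
move=> tr; elim/ltn_ind: t => -[|t] IH tn.
  exists set0; split; [|by move=> i; rewrite inE|by rewrite big_set0 W0].
  by apply/sigma_pathP => // i j; rewrite inE.
have [[|i] [it ar ->]] := run_dist_attained tn.
  exists set0; split; [|by move=> i; rewrite inE|].
    by apply/sigma_pathP => // i j; rewrite inE.
  by rewrite big_set0 W0 subn0.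
have [S [/(sigma_pathP _ _ tr) Sp Sar SW]] := IH i.+1 it (leq_trans it (leqW tn)).
have iN : (i < n)%N by rewrite (leq_trans it).
(* The ordinal [o] has value [i] and stands for the position [i.+1], the minimizer that extends the
   path. *)
pose o := Ordinal iN.
have So j : j \in S -> (j < o)%N by move=> /Sar /andP[].
have oS : o \notin S by apply/negP => /So; rewrite ltnn.
exists (o |: S); split.
- apply/(sigma_pathP _ _ tr) => x y; rewrite !inE => /orP[/eqP ->|xS] /orP[/eqP ->|yS] xy.
  + by rewrite ltnn in xy.
  + by have := So _ yS; rewrite ltnNge ltnW.
  + have /andP[_] := Sar _ xS.
    by rewrite input_pos_ord (input_pos_ord o).
  + exact: Sp.
- move=> x; rewrite !inE => /orP[/eqP ->//|xS].
  have /andP[xi] := Sar _ xS; have /andP[_] := ar.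
  rewrite /arrow (ltn_trans xi)// input_pos_ord (input_pos_ord o).
  by case: (input_pos n t.+1) => // b ob xo; exact: tr ob.
- rewrite big_setU1//=; have := leq_W w it; rewrite WS /wt (input_pos_ord o).
  by move: SW => /= ->; lia.
Qed.

Lemma dmin_le_output : transitive prec ->
  (dmin prec sigma w <= output prec sigma w omega)%N.
Proof.
move=> tr; have [S [Sp _ SW]] := run_dist_path tr (leqnn n.+1).
have -> : output prec sigma w omega = run_dist n.+1.
  by rewrite /output /run_dist; congr dist; apply: val_inj; rewrite /= inordK.
suff <- : defect w S = run_dist n.+1 by exact: bigminn_le.
apply/(@addnI (\sum_(j in S) w j)); rewrite -SW W_total /total_weight /defect.
by rewrite [in RHS](bigID [in S])/=; congr (_ + _)%N; apply: eq_bigl => j; rewrite inE.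
Qed.

End Run.

(** * Deterministic guarantee along a fixed path *)

Section OptimalPath.
Variables (R : realType) (P : Type) (prec : rel P) (n : nat).
Variables (sigma : 'I_n -> P) (w : 'I_n -> nat) (delta : R) (C : {set 'I_n}).
Hypothesis C_path : {in C &, forall i j : 'I_n, (i < j)%N -> prec (sigma i) (sigma j)}.
Hypothesis delta_gt0 : 0 < delta.

(** An index of weight 0 has [q = 0] and is almost surely discarded at the step after its insertion,
    so it cannot be relied on. *)
Definition on_path (u : nat) : bool :=
  if input_pos n u is Some j then (j \in C) && (0 < w j)%N else false.

Definition path_weight (t : nat) : nat := (\sum_(1 <= u < t.+1 | on_path u) wt w u)%N.
Definition off_weight (t : nat) : nat := (\sum_(1 <= u < t.+1 | ~~ on_path u) wt w u)%N.

(* [surplus m < surplus t] says that more than the fraction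
   [delta / (1 + delta)] of the weight of ]m, t] lies on the path. *)
Definition surplus (t : nat) : R := (path_weight t)%:R - delta * (off_weight t)%:R.

Lemma W_split t : W w t = (path_weight t + off_weight t)%N.
Proof. by rewrite /W /path_weight /off_weight (bigID on_path). Qed.

Lemma path_weightS t :
  path_weight t.+1 = (path_weight t + if on_path t.+1 then wt w t.+1 else 0)%N.
Proof. by rewrite /path_weight big_mkcond big_nat_recr//= -big_mkcond. Qed.

Lemma off_weightS t :
  off_weight t.+1 = (off_weight t + if on_path t.+1 then 0 else wt w t.+1)%N.
Proof. by rewrite /off_weight big_mkcond big_nat_recr//= -big_mkcond; case: on_path. Qed.

Lemma path_weight_diff m t : (m <= t <= n)%N ->
  (path_weight t = path_weight m +
     \sum_(j < n.+2 | [&& on_path j, m < j & j <= t]) wt w j)%N.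
Proof.
move=> /andP[mt tn]; rewrite /path_weight (@big_cat_nat _ _ _ m.+1)//=; congr (_ + _)%N.
rewrite (@big_nat_widen _ _ _ m.+1 t.+1 n.+2); last by rewrite ltnS leqW.
rewrite big_geq_mkord; apply: eq_bigl => j.
by rewrite -andbA [X in _ && X]andbC.
Qed.

Lemma leq_off_weight s t : (s <= t)%N -> (off_weight s <= off_weight t)%N.
Proof.
move=> /subnK <-; elim: (t - s)%N => [//|d IH].
by rewrite addSn off_weightS; apply: leq_trans IH (leq_addr _ _).
Qed.

Lemma surplus_lt_on_path m : surplus m < surplus m.+1 -> on_path m.+1.
Proof.
rewrite /surplus path_weightS off_weightS; case: on_path => //.
rewrite addn0 natrD mulrDr => h.
have := mulr_ge0 (ltW delta_gt0) (ler0n R (wt w m.+1)) => h'; exfalso; lra.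
Qed.

Lemma off_weight_defect : (off_weight n = defect w C)%N.
Proof.
have := W_split n; rewrite W_total /total_weight (bigID [in C])/=.
suff -> : path_weight n = (\sum_(j in C) w j)%N.
  move/addnI <-; rewrite /defect; apply: eq_bigl => j; by rewrite inE.
rewrite /path_weight (sum_input_pos _ (fun j => (j \in C) && (0 < w j)%N))//.
rewrite [RHS](bigID (fun j => 0 < w j)%N)/= [X in (_ + X)%N]big1 ?addn0; last first.
  by move=> j /andP[_]; rewrite lt0n negbK => /eqP.
by apply: eq_big => [j|j _]; rewrite ?ltn_ord// /wt input_pos_ord.
Qed.

Lemma on_path_ord u : on_path u ->
  exists2 j : 'I_n, u = j.+1 & (j \in C) && (0 < w j)%N.
Proof.
by rewrite /on_path; case E: input_pos => [j|//] h; exists j => //; exact: input_posP.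
Qed.

Lemma on_path_arrow i t : on_path i -> on_path t || (t == n.+1)%N -> (i < t)%N ->
  arrow prec sigma i t.
Proof.
move=> /on_path_ord[j -> /andP[jC _]] ct jt; rewrite /arrow jt input_pos_ord /=.
case/orP: ct => [|/eqP ->]; last by rewrite /input_pos insubF ?ltnn.
move=> /on_path_ord[l lt /andP[lC _]]; rewrite lt in jt *.
by rewrite input_pos_ord; exact: C_path.
Qed.

Variable omega : coins n.

(** Strong induction from the last remembered path index [m], or 0 if there is none. All path
    indices of []m, t]] are then lost, so the hypothesis bounds the path weight passed over by
    [delta] times the other weight. *)
Lemma run_dist_off_weight :
  (forall m s, (m < s <= n)%N ->
     (forall u, (m < u <= s)%N -> on_path u -> ~~ kept omega u s) ->
     surplus s <= surplus m) ->
  forall t, (t <= n.+1)%N -> on_path t || (t == n.+1)%N || (t == 0)%N ->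
  (run_dist prec sigma w omega t)%:R <= (1 + delta) * (off_weight t.-1)%:R.
Proof.
move=> nofail; elim/ltn_ind => -[|t] IH tn ct.
  by rewrite /run_dist/= mulr_ge0 ?ler0n// addr_ge0// ltW.
have {}ct : on_path t.+1 || (t.+1 == n.+1)%N by rewrite orbF in ct.
pose cand m := (m <= t)%N && ((m == 0)%N || on_path m && kept omega m t).
have ex_cand : exists m, cand m by exists 0%N.
have cand_le m : cand m -> (m <= t)%N by case/andP.
case: (ex_maxnP ex_cand cand_le) => m /andP[mt cm] max_m.
have ar : arrow prec sigma m t.+1.
  case/orP: cm => [/eqP ->//|/andP[om _]]; exact: on_path_arrow.
have km : (m == 0)%N || kept omega m t.
  by case/orP: cm => [->//|/andP[_ ->]]; rewrite orbT.
have le_run := @run_dist_le _ prec _ sigma w omega t m tn mt km ar.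
have IHm : (run_dist prec sigma w omega m)%:R <= (1 + delta) * (off_weight m)%:R.
  apply: (le_trans (IH m _ _ _)) => //; first exact: leq_trans mt (ltnW tn).
  - by case/orP: cm => [->|/andP[->]]; rewrite ?orbT.
  - apply: ler_wpM2l; first by rewrite addr_ge0// ltW.
    by rewrite ler_nat leq_off_weight// leq_pred.
have surp : surplus t <= surplus m.
  have [<-//|m_lt] := eqVneq m t.
  apply: nofail => [|u /andP[mu ut] ou]; first by rewrite ltn_neqAle m_lt mt -ltnS.
  apply/negP => ku; have := max_m u; rewrite /cand ut ou ku orbT leqNgt mu => /(_ isT).
  by [].
have leW := leq_W w mt.
apply: (@le_trans _ _ ((run_dist prec sigma w omega m)%:R + ((W w t)%:R - (W w m)%:R))).
  by rewrite -natrB// -natrD ler_nat.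
move: surp; rewrite /surplus !W_split !natrD/=; lra.
Qed.

(** Taking [m] as large as possible for [s] makes every prefix []m, u]] good: if
    [surplus u < surplus s] for some [u] strictly between, then [u] would be a larger choice.
    Failures can then be counted by left end alone. *)
Lemma output_fail :
  (1 + delta) * (defect w C)%:R < (output prec sigma w omega)%:R :> R ->
  exists m s, [/\ (m < s <= n)%N,
     forall u, (m < u <= s)%N -> on_path u -> ~~ kept omega u s &
     forall u, (m < u <= s)%N -> surplus m < surplus u].
Proof.
have -> : output prec sigma w omega = run_dist prec sigma w omega n.+1.
  by rewrite /output /run_dist; congr dist; apply: val_inj; rewrite /= inordK.
rewrite -off_weight_defect => fail.
pose dead m s := all (fun u => on_path u ==> ~~ kept omega u s) (iota m.+1 (s - m)).
have deadP m s : reflect (forall u, (m < u <= s)%N -> on_path u -> ~~ kept omega u s)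
    (dead m s).
  apply: (iffP allP) => [h u mus|h u]; last first.
    by rewrite mem_iota => mus; apply/implyP; apply: h; lia.
  by apply/implyP/h; rewrite mem_iota; lia.
pose bad s m := [&& (m < s)%N, dead m s & surplus m < surplus s].
have [|none] := boolP (has (fun s => has (bad s) (iota 0 s)) (iota 0 n.+1)); last first.
  have := run_dist_off_weight _ (leqnn n.+1); rewrite eqxx orbT => /(_ _ isT).
  rewrite /= leNgt fail => h; suff : false by []; apply: h => m s msn /deadP d.
  rewrite leNgt; apply/negP => lt; move/negP: none; apply; apply/hasP; exists s.
    by rewrite mem_iota; lia.
  by apply/hasP; exists m; rewrite ?mem_iota ?/bad ?d ?lt; lia.
case/hasP => s; rewrite mem_iota => sn /hasP[m0 _ bad0].
have ex_bad : exists m, bad s m by exists m0.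
have bad_le m : bad s m -> (m <= s)%N by move=> /and3P[/ltnW].
case: (ex_maxnP ex_bad bad_le) => m /and3P[ms /deadP dead_m lt_m] max_m.
exists m, s; split => //; first by rewrite ms; lia.
move=> u /andP[mu us]; have [->//|u_s] := eqVneq u s.
have u_lt : (u < s)%N by rewrite ltn_neqAle u_s.
apply: (lt_le_trans lt_m); rewrite leNgt; apply/negP => lt_u.
have : bad s u.
  rewrite /bad u_lt lt_u andbT/=; apply/deadP => v /andP[uv vs]; apply: dead_m.
  by rewrite vs andbT (ltn_trans mu).
by move=> /max_m; rewrite leqNgt mu.
Qed.

End OptimalPath.

(** * Survival probabilities *)

(* The factor on the right is the clipped ratio of consecutive sampling
   probabilities.  The logarithmic factor [k] is frozen, because the product of
   the clipped ratios may lie below the last sampling probability. *)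
Lemma min1_step_le (R : realFieldType) (V V' c c' k : R) :
  0 < V -> V <= V' -> 0 < c -> c <= c' -> 0 < k -> k <= c' ->
  Num.min 1 (k / V) <= Num.min 1 (c / V) ->
  Num.min 1 (k / V') <= Num.min 1 (k / V) *
    Num.max 0 (Num.min 1 (Num.min 1 (c' / V') / Num.min 1 (c / V))).
Proof.
move=> V0 VV' c0 cc' k0 kc' kq.
have V'0 : 0 < V' by apply: lt_le_trans VV'.
have c'0 : 0 < c' by apply: lt_le_trans cc'.
have kV : k / V' <= k / V by rewrite ler_pM2l// lef_pV2.
have kc : k / V' <= c' / V' by rewrite ler_pM2r// invr_gt0.
set q := Num.min 1 (c / V) in kq *; set q' := Num.min 1 (c' / V').
have q0 : 0 < q by rewrite lt_min ltr01 divr_gt0.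
have q'0 : 0 < q' by rewrite lt_min ltr01 divr_gt0.
have le_kq' : Num.min 1 (k / V') <= q' by rewrite /q' le_min ge_min lexx ge_min kc orbT.
rewrite max_r; last by rewrite le_min ler01 divr_ge0// ltW.
have [qq'|q'q] := leP 1 (q' / q).
  by rewrite mulr1 le_min !ge_min lexx kV orbT.
have {q'q} q'q : q' < q by move: q'q; rewrite ltr_pdivrMr// mul1r.
have [kV1|kV1] := leP 1 (k / V).
  have q1 : q = 1.
    apply/eqP; rewrite eq_le {1}/q ge_min lexx/=; move: kq.
    by rewrite (min_idPl kV1).
  by rewrite q1 divr1 mul1r.
rewrite ge_min; apply/orP; right.
(* In the unclipped case the claim amounts to [V * q <= V' * q'], which is the monotonicity of
   [Num.min V c] in both arguments. *)
have qV : V * q = Num.min V c.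
  by rewrite /q minr_pMr ?mulr1 1?mulrC ?divfK ?gt_eqF ?ltW.
have q'V : V' * q' = Num.min V' c'.
  by rewrite /q' minr_pMr ?mulr1 1?mulrC ?divfK ?gt_eqF ?ltW.
have VqV'q' : V * q <= V' * q' by rewrite qV q'V le_min !ge_min VV' cc' orbT.
have -> : k / V * (q' / q) = k * (V' * q') / (V * q) / V'.
  by field; rewrite !gt_eqF.
rewrite ler_pM2r ?invr_gt0// ler_pdivlMr ?mulr_gt0// ler_pM2l//.
Qed.

Lemma W_subr_gt0 (R : realFieldType) (n : nat) (w : 'I_n -> nat) (i t : nat) :
  (0 < i <= t)%N -> (0 < wt w i)%N ->
  0 < (W w t)%:R - (W w i.-1)%:R :> R.
Proof.
move=> /andP[i0 it] wi; rewrite subr_gt0 ltr_nat.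
by apply: leq_trans (leq_W w it); case: i i0 wi {it} => //= i _ wi; rewrite WS; lia.
Qed.

Section Survival.
Variables (R : realType) (n : nat) (w : 'I_n -> nat) (delta gamma : R).
Hypotheses (delta_gt0 : 0 < delta) (delta_le1 : delta <= 1).
Hypotheses (gamma_gt0 : 0 < gamma) (gamma_lt2 : gamma < 2).

Definition keep_coin (i t : 'I_n.+2) : R := keep_prob w delta gamma i t.

Definition log_factor (t : nat) : R := ln (4 * t%:R ^+ 3 / gamma).

Let kappa : R := (1 + delta) / delta.

Lemma keep_coin01 i t : 0 <= keep_coin i t <= 1.
Proof.
by rewrite /keep_coin /keep_prob le_max lexx ge_max ler01 ge_min lexx.
Qed.

Lemma PrE (A : pred (coins n)) : Pr w delta gamma A =
  expect (fun i => coin_row (keep_coin i)) (fun f => (A [ffun c => f c.1 c.2])%:R).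
Proof.
rewrite -(coins_expect keep_coin (fun omega => (A omega)%:R)) /Pr big_mkcond.
by apply: eq_bigr => omega _; case: (A omega); rewrite ?mulr1 ?mulr0.
Qed.

Lemma log_arg_gt2 t : (0 < t)%N -> 2 < 4 * t%:R ^+ 3 / gamma.
Proof.
move=> t0; rewrite ltr_pdivlMr//.
have : 1 <= t%:R ^+ 3 :> R by rewrite exprn_ege1// ler1n.
by move: gamma_lt2; lra.
Qed.

Lemma log_factor_nd s t : (0 < s <= t)%N -> log_factor s <= log_factor t.
Proof.
move=> /andP[s0 st]; rewrite /log_factor ler_ln ?posrE; last 2 first.
- by apply: lt_trans (log_arg_gt2 s0).
- by apply: lt_trans (log_arg_gt2 (leq_trans s0 st)).
rewrite ler_pM2r ?invr_gt0// ler_pM2l// lerXn2r ?nnegrE//.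
by rewrite ler_nat.
Qed.

Lemma log_factor_ge_half t : (0 < t)%N -> 1 / 2 <= log_factor t.
Proof.
move=> t0; apply: le_trans (ln2_ge_half R) _.
by rewrite ler_ln ?posrE// ?ltW ?log_arg_gt2// (lt_trans _ (log_arg_gt2 t0)).
Qed.

(** The shift to [t.+1] reaches the range of convexity: the argument of the logarithm is at least
    [4 * 2 ^+ 3 / 2 = 16], and [expR 2 <= 16]. *)
Lemma log_factor_ge2 t : (0 < t)%N -> 2 <= log_factor t.+1.
Proof.
move=> t0; rewrite /log_factor -ler_expR lnK; last first.
  by rewrite posrE (lt_trans _ (log_arg_gt2 (ltn0Sn t))).
apply: (@le_trans _ _ 16).
  have -> : (2 : R) = 1 + 1 by lra.
  rewrite expRD; have := expR1_le4 R; have := expR_gt0 (1 : R); nra.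
rewrite ler_pdivlMr//.
have : 2 ^+ 3 <= t.+1%:R ^+ 3 :> R by rewrite lerXn2r ?nnegrE// ler_nat.
by move: gamma_lt2; lra.
Qed.

Lemma expRN_log_factor t : (0 < t)%N ->
  expR (- log_factor t) = gamma / (4 * t%:R ^+ 3).
Proof.
move=> t0; rewrite expRN lnK ?posrE ?(lt_trans _ (log_arg_gt2 t0))//.
by rewrite invf_div.
Qed.

Let kappa_ge2 : 2 <= kappa.
Proof. by rewrite ler_pdivlMr//; move: delta_le1; lra. Qed.

Lemma q_diag (i : nat) : (0 < i)%N -> (0 < wt w i)%N -> q w delta gamma i i = 1.
Proof.
move=> i0 wi; apply/min_idPl.
have -> : (W w i)%:R - (W w i.-1)%:R = (wt w i)%:R :> R.
  by have := WS w i.-1; rewrite prednK// => ->; rewrite natrD addrAC subrr add0r.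
rewrite mulfV ?mulr1 ?pnatr_eq0 -?lt0n//.
have := log_factor_ge_half i0; rewrite -/kappa -/(log_factor i).
by have := kappa_ge2; nra.
Qed.

Lemma q_ge0 (i t : nat) : (0 < t)%N -> (i <= t)%N -> 0 <= q w delta gamma i t.
Proof.
move=> t0 it; rewrite le_min ler01/=; apply: mulr_ge0.
  have := log_factor_ge_half t0; rewrite -/kappa -/(log_factor t).
  by have := kappa_ge2; nra.
by rewrite divr_ge0// subr_ge0 ler_nat leq_W// (leq_trans (leq_pred i)).
Qed.

(** The logarithm is frozen at [i.+1], the first step at which a ratio of two values of [q] is used
    for [i]. *)
Lemma surv_ge (i : 'I_n.+2) t : (0 < i)%N -> (0 < wt w i)%N -> (i <= t <= n)%N ->
  Num.min 1 (kappa * (wt w i)%:R * log_factor i.+1 * ((W w t)%:R - (W w i.-1)%:R)^-1)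
    <= surv (keep_coin i) i t.
Proof.
move=> i0 wi /andP[]; elim: t => [|t IH]; first by rewrite leqn0 => /eqP i00; lia.
have wR : 0 < (wt w i)%:R :> R by rewrite ltr0n.
have kappa0 : 0 < kappa by move: kappa_ge2; lra.
have lf0 u : (0 < u)%N -> 0 < log_factor u.
  by move/log_factor_ge_half; lra.
rewrite leq_eqVlt => /orP[/eqP it _|it tn].
  by rewrite -it surv_id /keep_coin /keep_prob /p eqxx minxx max_r// ge_min lexx.
have tN : (t.+1 < n.+2)%N by rewrite ltnS ltnW.
rewrite (survS _ tN) ?(ltnW it)//.
apply: le_trans (ler_wpM2r _ (IH it (ltnW tn))); last first.
  by have /andP[] := keep_coin01 i (Ordinal tN).
pose V u : R := (W w u)%:R - (W w i.-1)%:R.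
pose c u := kappa * log_factor u * (wt w i)%:R.
have qE u : q w delta gamma i u = Num.min 1 (c u / V u) by rewrite /q mulrA.
rewrite /keep_coin /keep_prob /p /= ltn_eqF// !qE/=.
have c_nd u v : (0 < u <= v)%N -> c u <= c v.
  by move=> uv; rewrite ler_pM2r// ler_pM2l// log_factor_nd.
have kE : kappa * (wt w i)%:R * log_factor i.+1 = c i.+1 by rewrite mulrAC.
have V_gt0 u : (i <= u)%N -> 0 < V u by move=> iu; apply: W_subr_gt0; rewrite ?i0.
have c_gt0 u : (0 < u)%N -> 0 < c u by move=> u0; do 2!apply: mulr_gt0 => //; exact: lf0.
have t0 : (0 < t)%N by exact: leq_trans i0 it.
rewrite kE; apply: min1_step_le.
- exact: V_gt0.
- by rewrite lerD2r ler_nat leq_W.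
- exact: c_gt0.
- by apply: c_nd; rewrite t0/=.
- exact: c_gt0.
- exact: c_nd.
move: it; rewrite ltnS leq_eqVlt => /orP[/eqP <-|it]; last first.
  have ct : c i.+1 / V t <= c t / V t.
    by apply: ler_wpM2r; [rewrite invr_ge0 ltW// V_gt0// ltnW|exact: c_nd].
  by rewrite le_min !ge_min lexx ct orbT.
by rewrite -(qE i) q_diag// ge_min lexx.
Qed.

(** Clipping at 1 only lowers the factors, so the telescoping product is an upper bound. At [t = i]
    this fails for weight 0, where survival is 1 and [q] is 0. *)
Lemma surv_le (i : 'I_n.+2) t : (0 < i < t)%N -> (t <= n)%N ->
  surv (keep_coin i) i t <= q w delta gamma i t.
Proof.
move=> /andP[i0]; elim: t => // t IH; rewrite ltnS => it tn.
have tN : (t.+1 < n.+2)%N by rewrite ltnS ltnW.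
rewrite (survS _ tN) ?(leqW it)//.
pose Q u := q w delta gamma i u.
have Q0 u : (i <= u)%N -> 0 <= Q u by move=> iu; apply: q_ge0 => //; exact: leq_trans iu.
have keep_le : keep_coin i (Ordinal tN) <= Q t.+1 / Q t.
  rewrite /keep_coin /keep_prob /p /= ltn_eqF//= ge_max ge_min lexx orbT andbT.
  by rewrite divr_ge0 ?Q0// ltnW.
have /andP[keep0 keep1] := keep_coin01 i (Ordinal tN).
have [it'|ti] := ltnP i t.
  have le1 := IH it' (ltnW tn); have [Qt0|Qt0] := eqVneq (Q t) 0.
    have : surv (keep_coin i) i t * keep_coin i (Ordinal tN) <=
        Q t * keep_coin i (Ordinal tN).
      exact: ler_wpM2r.
    by rewrite Qt0 mul0r => /le_trans; apply; apply: Q0; exact: ltnW.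
  rewrite -[leRHS](mulfVK Qt0) mulrC; apply: ler_pM => //.
  by apply: prodr_ge0 => u _; have /andP[] := keep_coin01 i u.
have {ti it} ti : t = i by apply/eqP; rewrite eqn_leq ti -ltnS.
have -> : surv (keep_coin i) i t = 1.
  by rewrite ti surv_id /keep_coin /keep_prob /p eqxx minxx max_r.
rewrite mul1r.
apply: le_trans keep_le _; have -> : Q t = Q i by rewrite ti.
have [wi|] := posnP (wt w i); last by move=> wi; rewrite {2}/Q q_diag// divr1.
have -> : Q i = 0 by rewrite /Q /q wi mul0r mulr0 min_r.
by rewrite invr0 mulr0; apply: (Q0 t.+1); rewrite ti.
Qed.

End Survival.

(** * The approximation ratio *)

(** Each term with [j >= 1] is at most [1 / (j + 1) - 1 / (j + 2)], since
    [j * (j + 2) <= (j + 1) ^+ 2]. *)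
Lemma sum_div_cube_le (R : realFieldType) (M : nat) :
  \sum_(0 <= j < M) (j%:R / j.+1%:R ^+ 3 : R) <= 1 / 2.
Proof.
suff : \sum_(0 <= j < M.+1) (j%:R / j.+1%:R ^+ 3 : R) <= 1 / 2 - 1 / M.+2%:R.
  rewrite big_nat_recr//= => le; apply: (le_trans _ (le_trans le _)).
    by rewrite lerDl divr_ge0// exprn_ge0.
  by rewrite gerBl divr_ge0.
elim: M => [|M IH]; first by rewrite big_nat1 mul0r subrr.
rewrite big_nat_recr//=; apply: le_trans (lerD IH (lexx _)) _.
set x : R := M.+1%:R.
have -> : M.+3%:R = x + 2 by rewrite /x -(natrD _ _ 2) addn2.
have -> : M.+2%:R = x + 1 by rewrite /x natr1.
have x1 : 1 <= x by rewrite ler1n.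
suff : x / (x + 1) ^+ 3 <= 1 / (x + 1) - 1 / (x + 2) by lra.
have -> : 1 / (x + 1) - 1 / (x + 2) = ((x + 1) ^+ 2 / (x + 2)) / (x + 1) ^+ 3.
  by field; apply/andP; split; rewrite gt_eqF//; lra.
rewrite ler_pM2r ?invr_gt0 ?exprn_gt0//; last by lra.
by rewrite ler_pdivlMr; nra.
Qed.

Section ApproximationProbability.
Variables (R : realType) (P : Type) (prec : rel P) (n : nat).
Variables (sigma : 'I_n -> P) (w : 'I_n -> nat) (delta gamma : R) (C : {set 'I_n}).
Hypothesis C_path : {in C &, forall i j : 'I_n, (i < j)%N -> prec (sigma i) (sigma j)}.
Hypotheses (delta_gt0 : 0 < delta) (delta_le1 : delta <= 1).
Hypotheses (gamma_gt0 : 0 < gamma) (gamma_lt2 : gamma < 2).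

Let surp := surplus w delta C.
Let on := on_path w C.

Definition forgets (m : nat) (omega : coins n) : bool :=
  has (fun t => all (fun u => surp m < surp u) (iota m.+1 (t - m)) &&
    [forall j : 'I_n.+2, [&& on j, (m < j)%N & (j <= t)%N] ==> ~~ kept omega j t])
    (iota m.+1 (n - m)).

(** An instance of the extinction bound with left end [m.+1], where [V t] is the weight of []m, t]].
    If []m, m.+1]] is not good, the event is empty. *)
Lemma forgets_prob_le m : (m < n)%N ->
  Pr w delta gamma (forgets m) <=
  expR 1 * \sum_(j < n.+2 | on j && (m < j)%N) expR (- log_factor gamma j.+1).
Proof.
move=> mn.
pose good t := all (fun u => surp m < surp u) (iota m.+1 (t - m)).
have goodP t : reflect (forall u, (m < u <= t)%N -> surp m < surp u) (good t).
  apply: (iffP allP) => h u; last by rewrite mem_iota => ?; apply: h; lia.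
  by move=> ?; apply: h; rewrite mem_iota; lia.
have [lt1|ge1] := boolP (surp m < surp m.+1); last first.
  rewrite PrE /expect big1; last first.
    move=> f _; suff -> : forgets m [ffun c => f c.1 c.2] = false by rewrite mulr0.
    apply/negbTE/hasPn => t; rewrite mem_iota => mt; rewrite negb_and; apply/orP; left.
    by apply: contra ge1 => /goodP; apply; lia.
  by rewrite mulr_ge0 ?expR_ge0//; apply: sumr_ge0 => j _; exact: expR_ge0.
have ex_good : exists t, (t <= n)%N && good t.
  exists m.+1; rewrite mn; apply/goodP => u mu.
  by have -> : u = m.+1 by lia.
have good_le t : (t <= n)%N && good t -> (t <= n)%N by case/andP.
(* [good] passes to smaller times, so the times relevant to [forgets] form the interval from [m.+1]
   to [b]. *)
case: (ex_maxnP ex_good good_le) => b /andP[bn /goodP good_b] max_b.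
have mb : (m < b)%N.
  by apply: max_b; rewrite mn; apply/goodP => u mu; have -> : u = m.+1 by lia.
pose J (j : 'I_n.+2) := on j && (m < j)%N.
pose c (j : 'I_n.+2) : R := (1 + delta) / delta * (wt w j)%:R.
pose V (t : nat) : R := (W w t)%:R - (W w m)%:R.
have on_wt u : on u -> (0 < wt w u)%N.
  by move=> /on_path_ord[j -> /andP[_]]; rewrite /wt input_pos_ord.
have on_le u : on u -> (u <= n)%N by move=> /on_path_ord[j -> _].
have kappa_gt0 : 0 < (1 + delta) / delta by rewrite divr_gt0// addr_gt0.
apply: (@le_trans _ _ (expect (fun i => coin_row (keep_coin w delta gamma i))
    (fun f => (some_extinct J m.+1 b f)%:R))).
  rewrite PrE; apply: ler_expect => [|f].
    exact: coin_rows_law (keep_coin01 _ _ _).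
  have [/hasP[t]|_] := boolP (forgets m _); last by case: some_extinct.
  rewrite mem_iota => mt /andP[good_t /forallP dead].
  rewrite (_ : some_extinct _ _ _ _)//; apply/hasP; exists t.
    have : (t <= b)%N by apply: max_b; apply/andP; split; [lia|exact: good_t].
    by rewrite mem_index_iota; lia.
  apply/forallP => j; apply/implyP => /andP[/andP[oj mj] jt].
  have := dead j; rewrite oj mj jt /= /kept inord_val.
  by congr (~~ alive _ _ _); apply/ffunP => u; rewrite !ffunE.
have on_m1 : on m.+1 by apply: surplus_lt_on_path lt1.
apply: (@extinction_prob_le R n.+2 m.+1 b J c (fun j => log_factor gamma j.+1) V) => //.
- lia.
- by move=> j /andP[].
- by move=> j /andP[/on_wt wj _]; rewrite mulr_gt0// ltr0n.
- by move=> j /andP[_ mj]; apply: log_factor_ge2 => //; lia.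
- move=> t mtb; rewrite /V.
  by apply: (@W_subr_gt0 R n w m.+1); [lia|exact: on_wt].
- by move=> t _; rewrite lerD2r ler_nat leq_W.
(* Goodness of []m, t]] says that its path weight times [(1 + delta) / delta] exceeds its whole
   weight. *)
- move=> t mtb; have := good_b t mtb; rewrite /surp /surplus => lt_t.
  have -> : \sum_(j | J j && (j <= t)%N) c j =
      (1 + delta) / delta * ((path_weight w C t)%:R - (path_weight w C m)%:R).
    rewrite -mulr_sumr; congr (_ * _).
    rewrite (@path_weight_diff _ w C m t); last by lia.
    rewrite natrD addrAC subrr add0r natr_sum; apply: eq_bigl => j.
    by rewrite /J -andbA.
  rewrite /V !(W_split w C) !natrD mulrAC ler_pdivlMr//.
  by move: lt_t; lra.
- exact: keep_coin01.
- move=> j t /andP[oj mj] jtb; apply: le_trans (surv_ge _ _ _ _ _ _ _) => //.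
  (* Moving the left end from [j] back to [m.+1] enlarges the denominator, giving all indices the
     same [V]. *)
  + rewrite le_min ge_min lexx/= ge_min; apply/orP; right.
    have Vj : 0 < (W w t)%:R - (W w j.-1)%:R :> R.
      by apply: W_subr_gt0; [lia|exact: on_wt].
    apply: ler_wpM2l.
      rewrite mulr_ge0 ?(ltW (mulr_gt0 _ _)) ?ltr0n ?on_wt//.
      by have := log_factor_ge2 gamma_gt0 gamma_lt2 (leq_trans (ltn0Sn m) mj); lra.
    have le_W : (W w m)%:R <= (W w j.-1)%:R :> R by rewrite ler_nat leq_W//; lia.
    have Vle : (W w t)%:R - (W w j.-1)%:R <= V t by rewrite lerD2l lerN2.
    by rewrite lef_pV2 ?posrE// (lt_le_trans Vj).
  + lia.
  + exact: on_wt.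
  + lia.
Qed.

End ApproximationProbability.

Section Approximation.
Variables (R : realType) (P : Type) (prec : rel P) (n : nat).
Variables (sigma : 'I_n -> P) (w : 'I_n -> nat) (delta gamma : R) (C : {set 'I_n}).
Hypothesis C_path : {in C &, forall i j : 'I_n, (i < j)%N -> prec (sigma i) (sigma j)}.
Hypotheses (delta_gt0 : 0 < delta) (delta_le1 : delta <= 1).
Hypotheses (gamma_gt0 : 0 < gamma) (gamma_lt2 : gamma < 2).

Lemma Pr_le1 (A : pred (coins n)) : Pr w delta gamma A <= 1.
Proof.
rewrite PrE -[leRHS](expect_cst 1 (coin_rows_law (keep_coin01 w delta gamma))).
apply: ler_expect => [|f]; first exact: coin_rows_law (keep_coin01 _ _ _).
by case: (A _); rewrite ?lexx ?ler01.
Qed.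

Lemma Pr_union (A : pred (coins n)) (r : seq nat) (B : nat -> pred (coins n)) :
  (forall omega, A omega -> has (B ^~ omega) r) ->
  Pr w delta gamma A <= \sum_(b <- r) Pr w delta gamma (B b).
Proof.
move=> sub; under eq_bigr do rewrite PrE; rewrite PrE -expect_sum.
apply: ler_expect => [|f]; first exact: coin_rows_law (keep_coin01 _ _ _).
have nneg b : 0 <= (B b [ffun c => f c.1 c.2])%:R :> R by case: (B _ _).
have [/sub/hasP[b br Bb]|_] := boolP (A _); last exact: sumr_ge0.
by rewrite (big_rem b)//= Bb lerDl sumr_ge0.
Qed.

Lemma output_prob_le :
  Pr w delta gamma (fun omega =>
    (1 + delta) * (defect w C)%:R < (output prec sigma w omega)%:R) <= gamma / 2.
Proof.
apply: (@le_trans _ _ (\sum_(m <- iota 0 n) Pr w delta gamma (forgets w delta C m))).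
  apply: Pr_union => omega /(output_fail C_path delta_gt0)[m [s [msn dead good]]].
  apply/hasP; exists m; first by rewrite mem_iota; lia.
  apply/hasP; exists s; first by rewrite mem_iota; lia.
  apply/andP; split.
    by apply/allP => u; rewrite mem_iota => mu; apply: good; lia.
  by apply/forallP => j; apply/implyP => /and3P[oj mj js]; apply: dead; rewrite ?mj.
apply: (@le_trans _ _ (\sum_(m <- iota 0 n) expR 1 *
    \sum_(j < n.+2 | on_path w C j && (m < j)%N) expR (- log_factor gamma j.+1))).
  rewrite big_seq [leRHS]big_seq; apply: ler_sum => m; rewrite mem_iota => mn.
  by apply: forgets_prob_le => //; lia.
(* After the exchange, an index [j] is charged once for each left end [m < j], hence at most [j]
   times. *)
rewrite -mulr_sumr (exchange_big_dep predT)//=.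
have row_le (j : 'I_n.+2) : \sum_(m <- iota 0 n | on_path w C j && (m < j)%N)
    expR (- log_factor gamma j.+1) <= gamma / 4 * (j%:R / j.+1%:R ^+ 3).
  rewrite big_const_seq iter_addr_0 expRN_log_factor// -[leLHS]mulr_natl.
  have -> : gamma / 4 * (j%:R / j.+1%:R ^+ 3) = j%:R * (gamma / (4 * j.+1%:R ^+ 3)).
    by move: (j.+1%:R ^+ 3 : R) => x; rewrite invfM; ring.
  apply: ler_wpM2r; first by rewrite divr_ge0 ?mulr_ge0 ?exprn_ge0// ltW.
  rewrite ler_nat -size_filter -[leqRHS](size_iota 0 j).
  apply: uniq_leq_size; first by rewrite filter_uniq// iota_uniq.
  by move=> m; rewrite mem_filter !mem_iota => /andP[/andP[_ ->]].
apply: (@le_trans _ _ (4 * \sum_(j < n.+2) gamma / 4 * (j%:R / j.+1%:R ^+ 3))).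
  apply: ler_pM; rewrite ?expR_ge0 ?expR1_le4//; last exact: ler_sum.
  by apply: sumr_ge0 => j _; apply: sumr_ge0 => m _; exact: expR_ge0.
rewrite -mulr_sumr mulrA -(big_mkord predT (fun j => j%:R / j.+1%:R ^+ 3 : R)).
have := sum_div_cube_le R n.+2; set S := \sum_(0 <= j < n.+2) _.
by move: gamma_gt0; nra.
Qed.

End Approximation.

(** * The size of the memory *)

Section MemoryBound.
Variables (R : realType).

(** A potential for sums of [(d - d') / d] along decreasing integers; the extra 1 pays for the drop
    to 0, where the logarithm is of no use. *)
Let phi (d : nat) : R := if d is 0%N then 0 else 1 + ln d%:R.

Let phi_diff (d d' : nat) : (d' <= d)%N ->
  (d%:R - d'%:R) / d%:R <= phi d - phi d'.
Proof.
case: d => [|d] dd.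
  by move: dd; rewrite leqn0 => /eqP ->; rewrite !subrr mul0r.
have d0 : 0 < d.+1%:R :> R by rewrite ltr0n.
case: d' => [|d'] in dd *.
  rewrite !subr0 mulfV ?gt_eqF//= lerDl ln_ge0//.
  by rewrite ler1n.
have d'0 : 0 < d'.+1%:R :> R by rewrite ltr0n.
rewrite /phi opprD addrACA subrr add0r; move: d0 d'0.
move: (d.+1%:R : R) (d'.+1%:R : R) => x y x0 y0.
have := expR_ge1Dx (ln (y / x)); rewrite lnK ?posrE ?divr_gt0//.
by rewrite ln_div ?posrE// mulrBl mulfV ?gt_eqF//; lra.
Qed.

(** With [D i] the weight of [[i, s]], the numerator is [D i - D i.+1], and the sum telescopes
    through [phi]. *)
Lemma sum_weight_ratio_le (n : nat) (w : 'I_n -> nat) (s : nat) :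
  (0 < s <= n)%N -> (0 < total_weight w)%N ->
  \sum_(1 <= i < s) (wt w i)%:R / ((W w s)%:R - (W w i.-1)%:R) <=
  1 + ln (total_weight w)%:R :> R.
Proof.
move=> /andP[s0 sn] rho0.
pose D i := (W w s - W w i.-1)%N.
apply: (@le_trans _ _ (\sum_(1 <= i < s) - (phi (D i.+1) - phi (D i)))).
  rewrite big_nat_cond [leRHS]big_nat_cond; apply: ler_sum => i.
  rewrite andbT => /andP[i1 is_]; rewrite opprB.
  have Wi : W w i = (W w i.-1 + wt w i)%N by have := WS w i.-1; rewrite prednK.
  have Ws := leq_W w (ltnW is_).
  have DD : (D i.+1 <= D i)%N by rewrite /D/=; lia.
  have -> : (W w s)%:R - (W w i.-1)%:R = (D i)%:R :> R by rewrite natrB//; lia.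
  have -> : (wt w i)%:R = (D i)%:R - (D i.+1)%:R :> R.
    by rewrite -natrB//; congr _%:R; rewrite /D/=; lia.
  exact: phi_diff.
rewrite sumrN telescope_sumr// opprB.
have phi_ge0 d : 0 <= phi d by case: d => //= d; rewrite addr_ge0// ln_ge0// ler1n.
apply: (@le_trans _ _ (phi (D 1%N))); first by rewrite gerBl.
rewrite /D W0 subn0; case E: (W w s) => [|W'] /=.
  by rewrite addr_ge0// ln_ge0// ler1n.
by rewrite lerD2l ler_ln ?posrE ?ltr0n// ler_nat -E -W_total leq_W.
Qed.

Variables (P : Type) (prec : rel P) (n : nat).
Variables (sigma : 'I_n -> P) (w : 'I_n -> nat).

Definition kept_count (s : nat) (omega : coins n) : nat :=
  #|[set i : 'I_n.+2 | (0 < i < s)%N && kept omega i s]|.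

(** The three extra indices are 0, the new index [t.+1], and [t], to which the upper bound on
    survival does not apply. *)
Lemma card_inserted_le omega t : (t <= n)%N ->
  (#|inserted (run prec sigma w omega t) (inord t.+1)| <= 3 + kept_count t omega)%N.
Proof.
move=> tn.
pose K := [set i : 'I_n.+2 | (0 < i < t)%N && kept omega i t].
apply: (@leq_trans #|[set inord t.+1; ord0; inord t] :|: K|).
  apply: subset_leq_card; apply/subsetP => i; rewrite !inE.
  rewrite mem_run ?leqW// => /orP[->//|/orP[->|/and3P[i0 it ki]]]; first by rewrite orbT.
  move: it; rewrite leq_eqVlt => /orP[/eqP it|it]; last by rewrite i0 it ki !orbT.
  by rewrite -it inord_val eqxx !orbT.
apply: (leq_trans (leq_of_leqif (leq_card_setU _ _))); rewrite leq_add2r.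
apply: (leq_trans (leq_of_leqif (leq_card_setU _ _))).
by rewrite cards1 addn1 ltnS cards2; case: (_ != _).
Qed.

Lemma memory_exceeds_kept (B : R) omega : 3 <= B ->
  memory_exceeds prec sigma w B omega ->
  has (fun s => B < (3 + kept_count s omega)%:R) (iota 2 n.-1).
Proof.
move=> B3 ex.
have [t tn lt_t] : exists2 t, (t <= n)%N &
    B < #|inserted (run prec sigma w omega t) (inord t.+1)|%:R.
  have tlt (t' : 'I_n.+2) : (0 < t')%N -> (t'.-1 <= n)%N /\ inord t'.-1.+1 = t'.
    by move=> t0; rewrite prednK// inord_val; split=> //; have := ltn_ord t'; lia.
  case/orP: ex => /existsP[t]; last first.
    by case/andP => /tlt[tn tE] lt_t; exists t.-1; rewrite ?tE.
  have [t0|t0] := posnP t.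
    by rewrite t0 /= cards1 => lt1; exfalso; lra.
  move=> lt_t; have [tn tE] := tlt t t0; exists t.-1 => //.
  apply: (lt_le_trans lt_t); rewrite ler_nat; apply: subset_leq_card.
  rewrite -{1}(prednK t0) /=; apply/subsetP => i.
  by rewrite inE => /andP[].
have lt_t' : B < (3 + kept_count t omega)%:R.
  by apply: (lt_le_trans lt_t); rewrite ler_nat card_inserted_le.
apply/hasP; exists t => //; rewrite mem_iota.
(* For [t <= 1] nothing is counted, and 3 does not exceed [B]. *)
suff : (1 < t)%N by lia.
rewrite ltnNge; apply/negP => t1.
have k0 : kept_count t omega = 0%N.
  apply/eqP; rewrite cards_eq0; apply/eqP/setP => i; rewrite !inE.
  by apply/negbTE/negP => /andP[/andP[i0 it] _]; lia.
by move: lt_t'; rewrite k0 addn0; lra.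
Qed.

Variables delta gamma : R.
Hypotheses (delta_gt0 : 0 < delta) (delta_le1 : delta <= 1).
Hypotheses (gamma_gt0 : 0 < gamma) (gamma_lt2 : gamma < 2).

(** Chernoff's method with exponent 1: the indicator is at most [expR (3 + kept_count - B)], whose
    expectation factors over the independent indices. *)
Lemma kept_count_prob_le (B : R) s : (1 < s <= n)%N ->
  Pr w delta gamma (fun omega => B < (3 + kept_count s omega)%:R) <=
  expR (3 - B + (expR 1 - 1) * \sum_(1 <= i < s) q w delta gamma i s).
Proof.
move=> /andP[s1 sn].
pose K (i : 'I_n.+2) := (0 < i < s)%N.
pose F (i : 'I_n.+2) (y : {ffun 'I_n.+2 -> bool}) : R :=
  if K i && alive y i s then expR 1 else 1.
apply: (@le_trans _ _ (expect (fun i => coin_row (keep_coin w delta gamma i))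
    (fun f => expR (3 - B) * \prod_i F i (f i)))).
  rewrite PrE; apply: ler_expect => [|f]; first exact: coin_rows_law (keep_coin01 _ _ _).
  have F0 : 0 <= \prod_i F i (f i).
    by apply: prodr_ge0 => i _; rewrite /F; case: ifP => _; rewrite ?expR_ge0 ?ler01.
  case: ltP => [lt|_]; last by rewrite mulr_ge0// expR_ge0.
  have -> : \prod_i F i (f i) = expR (kept_count s [ffun c => f c.1 c.2])%:R.
    rewrite /F -big_mkcond/= -(@expR_sum R _ _ _ (fun=> 1)) sumr_const; congr (expR _%:R).
    apply: eq_card => i; rewrite !inE /K; congr (_ && _).
    rewrite /kept inord_val; congr (alive _ _ _).
    by apply/ffunP => u; rewrite !ffunE.
  rewrite /= -expRD; apply: (le_trans _ (expR_ge1Dx _)); move: lt; rewrite natrD; lra.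
have -> : expect (fun i => coin_row (keep_coin w delta gamma i))
    (fun f => expR (3 - B) * \prod_i F i (f i)) = expR (3 - B) *
    expect (fun i => coin_row (keep_coin w delta gamma i)) (fun f => \prod_i F i (f i)).
  by rewrite /expect mulr_sumr; apply: eq_bigr => f _; rewrite mulrCA.
rewrite [leRHS]expRD; apply: ler_wpM2l; first exact: expR_ge0.
rewrite expect_prod.
have e1 : 0 <= expR 1 - 1 :> R by have := expR_ge1Dx (1 : R); lra.
apply: (@le_trans _ _ (\prod_(i < n.+2 | K i)
    expR ((expR 1 - 1) * q w delta gamma i s))).
  rewrite [leRHS]big_mkcond; apply: ler_prod => i _; apply/andP; split.
    apply: sumr_ge0 => y _; apply: mulr_ge0.
      by apply: coin_row_ge0 => t; exact: keep_coin01.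
    by rewrite /F; case: ifP => _; rewrite ?expR_ge0 ?ler01.
  have [Ki|Ki] := boolP (K i); last first.
    by rewrite /F (negbTE Ki)/= -mulr_suml coin_row_sum1 mul1r.
  rewrite /F Ki /=.
  have -> : \sum_(y : {ffun 'I_n.+2 -> bool}) coin_row (keep_coin w delta gamma i) y *
      (if alive y i s then expR 1 else 1) =
      1 + (expR 1 - 1) * surv (keep_coin w delta gamma i) i s.
    transitivity (expR 1 * (\sum_(y : {ffun 'I_n.+2 -> bool})
          coin_row (keep_coin w delta gamma i) y) -
        (expR 1 - 1) * (\sum_(y : {ffun 'I_n.+2 -> bool})
          coin_row (keep_coin w delta gamma i) y * (~~ alive y i s)%:R)).
      rewrite !mulr_sumr -sumrB; apply: eq_bigr => y _.
      by case: alive => /=; ring.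
    by rewrite coin_row_sum1 coin_row_dead; ring.
  apply: (le_trans _ (expR_ge1Dx _)); rewrite lerD2l ler_wpM2l//.
  by apply: surv_le.
rewrite -expR_sum ler_expR mulr_sumr le_eqVlt; apply/orP; left; apply/eqP.
rewrite (@big_nat_widen _ _ _ 1 s n.+2); last by lia.
rewrite big_geq_mkord; apply: eq_bigl => i.
by rewrite /K andbC.
Qed.

End MemoryBound.

Section MemoryProbability.
Variables (R : realType) (P : Type) (prec : rel P) (n : nat).
Variables (sigma : 'I_n -> P) (w : 'I_n -> nat) (delta gamma : R).
Hypotheses (delta_gt0 : 0 < delta) (delta_le1 : delta <= 1).
Hypotheses (gamma_gt0 : 0 < gamma) (gamma_lt2 : gamma < 2).
Hypothesis rho_gt0 : (0 < total_weight w)%N.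

Let lf : R := log_factor gamma n.
Let b : R := 2 / delta * ln (2 * (total_weight w)%:R) * lf.
Let B : R := memory_bound w delta gamma.

Let n_gt0 : (0 < n)%N.
Proof. by case: n w rho_gt0 => // w'; rewrite /total_weight big_ord0. Qed.

Let B_eq : B = expR 1 ^+ 2 * b.
Proof. by rewrite /B /b /memory_bound -/(log_factor gamma n) -/lf; ring. Qed.

Let rhoR_ge1 : 1 <= (total_weight w)%:R :> R. Proof. by rewrite ler1n. Qed.

Let ln_rho_ge0 : 0 <= ln (total_weight w)%:R :> R.
Proof. exact: ln_ge0. Qed.

Let ln2rho : ln (2 * (total_weight w)%:R) = ln 2 + ln (total_weight w)%:R :> R.
Proof. by rewrite lnM ?posrE// ltr0n. Qed.

Let lf_ge_half : 1 / 2 <= lf. Proof. exact: log_factor_ge_half. Qed.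

Let inv_delta_ge1 : 1 <= delta^-1. Proof. by rewrite invf_ge1. Qed.

Let b_ge : lf <= b.
Proof.
have l2 : 1 / 2 <= ln (2 * (total_weight w)%:R) :> R.
  by rewrite ln2rho; have := ln2_ge_half R; move: ln_rho_ge0; lra.
have : 1 <= 2 / delta * ln (2 * (total_weight w)%:R) by move: inv_delta_ge1 l2; nra.
by rewrite /b; move: lf_ge_half; nra.
Qed.

(** Uses [1 + delta <= 2], the monotonicity of the logarithmic factor, and
    [1 + ln rho <= 2 * ln (2 * rho)], which follows from [ln 2 >= 1 / 2]. *)
Let sum_q_le s : (1 < s <= n)%N ->
  \sum_(1 <= i < s) q w delta gamma i s <= 2 * b.
Proof.
move=> /andP[s1 sn].
have s0 : (0 < s)%N by apply: ltnW.
apply: (@le_trans _ _ (2 / delta * lf *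
    \sum_(1 <= i < s) (wt w i)%:R / ((W w s)%:R - (W w i.-1)%:R))).
  rewrite mulr_sumr big_nat_cond [leRHS]big_nat_cond; apply: ler_sum => i.
  rewrite andbT => /andP[i1 is_]; rewrite /q ge_min; apply/orP; right.
  apply: ler_wpM2r.
    by rewrite divr_ge0// subr_ge0 ler_nat leq_W// (leq_trans (leq_pred i) (ltnW is_)).
  apply: ler_pM.
  - by rewrite divr_ge0 ?addr_ge0 ?ltW.
  - by have := log_factor_ge_half gamma_gt0 gamma_lt2 s0; rewrite /log_factor; lra.
  - by rewrite ler_pM2r ?invr_gt0//; move: delta_le1; lra.
  - by apply: log_factor_nd => //; rewrite s0.
have H := @sum_weight_ratio_le R n w s _ rho_gt0.
apply: (@le_trans _ _ (2 / delta * lf * (1 + ln (total_weight w)%:R))).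
  apply: ler_wpM2l; last by apply: H; rewrite s0.
  by move: inv_delta_ge1 lf_ge_half; nra.
rewrite /b ln2rho.
have l2 := ln2_ge_half R.
have -> : 2 * (2 / delta * (ln 2 + ln (total_weight w)%:R) * lf) =
  2 / delta * lf * (2 * (ln 2 + ln (total_weight w)%:R)) by ring.
apply: ler_wpM2l; first by move: inv_delta_ge1 lf_ge_half; nra.
by move: ln_rho_ge0; lra.
Qed.

Lemma memory_prob_le :
  Pr w delta gamma (memory_exceeds prec sigma w B) <= gamma / 2.
Proof.
have e2 : 2 <= expR 1 :> R by have := expR_ge1Dx (1 : R); lra.
have B3 : 3 <= B.
  by rewrite B_eq; have := expR1_sqr_ge6 R; move: b_ge lf_ge_half; nra.
pose r : R := gamma / (4 * n%:R ^+ 3).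
have n1 : 1 <= n%:R :> R by rewrite ler1n.
have term_le s : (1 < s <= n)%N ->
    Pr w delta gamma (fun omega => B < (3 + kept_count s omega)%:R) <= 64 * r ^+ 2.
  move=> sn; apply: le_trans; first exact: kept_count_prob_le.
  apply: (@le_trans _ _ (expR (3 - lf - lf))).
    rewrite ler_expR B_eq; have := sum_q_le sn.
    set S := \sum_(1 <= i < s) _ => Sb; move: b_ge lf_ge_half => lb l0.
    have : (expR 1 - 1) * S <= (expR 1 - 1) * (2 * b) by apply: ler_wpM2l; lra.
    (* This is [expR 1 >= 2] in disguise; together with [lf <= b] it leaves [- 2 * lf] in the
       exponent, hence the square of [r]. *)
    suff : 2 * b <= (expR 1 ^+ 2 - 2 * (expR 1 - 1)) * b by lra.
    by apply: ler_wpM2r; [lra|nra].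
  rewrite (expRD (3 - lf)) (expRD 3) expRN_log_factor// -/r -mulrA -expr2.
  apply: ler_wpM2r; first exact: sqr_ge0.
  have -> : (3 : R) = 3%:R * 1 by rewrite mulr1.
  rewrite expRM_natl (_ : 64 = 4 ^+ 3); last by ring.
  by rewrite lerXn2r ?nnegrE ?expR_ge0 ?expR1_le4.
apply: (@le_trans _ _ (\sum_(s <- iota 2 n.-1)
    Pr w delta gamma (fun omega => B < (3 + kept_count s omega)%:R))).
  by apply: Pr_union => omega; exact: memory_exceeds_kept.
apply: (@le_trans _ _ (\sum_(s <- iota 2 n.-1) 64 * r ^+ 2)).
  rewrite [leLHS]big_seq [leRHS]big_seq; apply: ler_sum => s.
  by rewrite mem_iota add2n ltnS prednK// => sn; exact: term_le.
rewrite big_const_seq iter_addr_0 count_predT size_iota -[leLHS]mulr_natl.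
have [n_le1|n_gt1] := leqP n 1.
  have -> : n.-1 = 0%N by apply/eqP; rewrite -leqn0 -ltnS prednK.
  by rewrite mul0r divr_ge0// ltW.
have n2 : 2 <= n%:R :> R by rewrite ler_nat.
apply: (@le_trans _ _ (n%:R * (64 * r ^+ 2))).
  apply: ler_wpM2r; first by rewrite mulr_ge0// sqr_ge0.
  by rewrite ler_nat leq_pred.
(* As [gamma < 2] and [n >= 2], the second factor is below [8 / 32]. *)
have -> : n%:R * (64 * r ^+ 2) = gamma * (gamma * 4 / n%:R ^+ 5).
  by rewrite /r; field; rewrite pnatr_eq0 -lt0n.
apply: ler_wpM2l; first exact: ltW.
have n5 : 2 ^+ 5 <= n%:R ^+ 5 :> R by rewrite lerXn2r ?nnegrE//; lra.
rewrite ler_pdivrMr ?exprn_gt0//; first by move: gamma_lt2; lra.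
by lra.
Qed.

End MemoryProbability.

Lemma lteif_trans_bool (disp : Order.disp_t) (P : porderType disp) (refl : bool) :
  transitive (fun x y : P => (x < y ?<= if refl)%O).
Proof. by move=> y x z; case: refl; [exact: le_trans|exact: lt_trans]. Qed.

(* The sequence order is the order of P, in its reflexive version if refl is  *)
(* true and in its strict version otherwise.                                  *)
Theorem theorem4 (R : realType) (disp : Order.disp_t) (P : porderType disp)
    (refl : bool) (n : nat) (sigma : 'I_n -> P) (w : 'I_n -> nat)
    (delta gamma : R)
    (delta_gt0 : 0 < delta) (delta_le1 : delta <= 1) (gamma_gt0 : 0 < gamma) :
  let prec : rel P := fun x y => (x < y ?<= if refl)%O in
  [/\ forall omega : coins n,
        (dmin prec sigma w <= output prec sigma w omega)%N,
      Pr w delta gamma (fun omega =>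
        (1 + delta) * (dmin prec sigma w)%:R
          < (output prec sigma w omega)%:R) <= gamma / 2
    & (0 < total_weight w)%N ->
      Pr w delta gamma
        (memory_exceeds prec sigma w (memory_bound w delta gamma))
        <= gamma / 2].
Proof.
move=> prec; have tr : transitive prec by exact: lteif_trans_bool.
(* For [gamma >= 2] both probability bounds are at least 1. Below 2, all logarithms at positive
   times are positive. *)
have [gamma_lt2|gamma_ge2] := ltP gamma 2; last first.
  have triv A : Pr w delta gamma A <= gamma / 2.
    by apply: (le_trans (Pr_le1 _ _ _ _)); lra.
  by split=> [omega||_]; [exact: dmin_le_output|exact: triv|exact: triv].
split=> [omega||rho_gt0]; [exact: dmin_le_output| |exact: memory_prob_le].
have [C Cp ->] : exists2 C : {set 'I_n}, {in C &, forall i j : 'I_n,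
    (i < j)%N -> prec (sigma i) (sigma j)} & dmin prec sigma w = defect w C.
  rewrite /dmin; case: (bigminn_attained (defect w set0)
    (sigma_path prec sigma) (defect w)) => [->|[C /(sigma_pathP _ _ tr) Cp ->]].
    by exists set0 => // i; rewrite inE.
  by exists C.
exact: output_prob_le.
Qed.
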